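(* Let $d\geq 1$, let $F\subseteq\mathbb{Z}^d$ be a finite configuration of $|F|=k\geq 3$ points, and let $\mu\in(0,\frac{k-1}{k})$ be real. Then there is a set of lattice points $X\subseteq\mathbb{N}^d$ such that (i) for every $r\geq 1$, every colouring of $X$ with $r$ colours contains a monochromatic homothetic copy of $F$, and (ii) every finite subset $Y\subseteq X$ has an $F$-free subset $Z\subseteq Y$ of size $|Z|\geq\mu|Y|$.
   Context: A homothetic copy of $F$ is a set $v+\lambda F=\{v+\lambda f\colon f\in F\}$ with $v\in\mathbb{Z}^d$ and $\lambda$ a positive integer. A set $Z\subseteq\mathbb{Z}^d$ is called $F$-free if there is no nonzero real number $\lambda$ such that $Z$ contains a congruent copy of $\lambda F$, i.e. a subset that is the image of $\lambda F=\{\lambda f\colon f\in F\}$ under an isometry of Euclidean space $\mathbb{R}^d$. *)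

(* Defs.v *)
From HB Require Import structures.
From mathcomp Require Import all_boot all_order all_algebra.
From mathcomp Require Import reals.
Set Implicit Arguments. Unset Strict Implicit. Unset Printing Implicit Defensive.
Import Order.TTheory GRing.Theory Num.Theory.
Local Open Scope ring_scope.

Definition lpt (d : nat) := 'rV[int]_d.

Definition embed (R : realType) (d : nat) (x : lpt d) : 'rV[R]_d :=
  map_mx (fun z : int => z%:~R) x.

Definition sqdist (R : realType) (d : nat) (x y : 'rV[R]_d) : R :=
  \sum_(i < d) (x 0 i - y 0 i) ^+ 2.

Definition isometry (R : realType) (d : nat) (g : 'rV[R]_d -> 'rV[R]_d) :=
  forall x y, sqdist (g x) (g y) = sqdist x y.

Definition F_free (R : realType) (d : nat) (F : seq (lpt d)) (Z : seq (lpt d)) :=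
  ~ (exists (lam : R) (g : 'rV[R]_d -> 'rV[R]_d),
        lam != 0 /\ isometry g /\
        forall f, f \in F -> exists2 z, z \in Z & embed R z = g (lam *: embed R f)).

Definition mono_homothetic_copy (d r : nat) (F : seq (lpt d))
    (X : lpt d -> Prop) (c : lpt d -> 'I_r) :=
  exists (v : lpt d) (lam : nat) (col : 'I_r),
    (0 < lam)%N /\
    forall f, f \in F -> X (v + (lam%:Z) *: f) /\ c (v + (lam%:Z) *: f) = col.

(* Main.v *)
(** The points of [X] are built by the partite construction over a [k]-uniform linear
    hypergraph [H] which is not [r]-colourable although its vertices carry a probability
    distribution on independent sets hitting every vertex with probability at least [mu].
    The edges of [H] come from increasing sequences [u] of length [width]: the [s]-th
    vertex drops [s] early and [k - 1 - s] late entries of [u], so that a middle entry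
    moves down by [s] places.  Ramsey's theorem makes [H] non-[r]-colourable; a random
    order of the ground set, together with the rule "the position of the minimum is a
    middle one and not divisible by [k]", yields the independent sets.

    The partite construction starts from disjoint lines over the edges of [H] and
    amalgamates along one vertex of [H] after the other by the Hales-Jewett theorem.
    Quasilines (families that are constant or injective in every coordinate) must keep
    projecting onto edges.  The only obstruction would be three Hales-Jewett lines whose
    active sets satisfy [A2 = A0 + A1] (disjoint union); Shelah's proof of the
    Hales-Jewett theorem can be run so that no such triple occurs.

    Finally the words are mapped to the lattice by [x |-> sum_i q_i f_(x_i)] with rapidly
    growing weights, so that every similar copy of [F] comes from a quasiline, and the
    finite sets obtained for [r = 1, 2, ...] are placed extremely far apart; as [F] has
    at least three points, no similar copy of [F] meets two of them. *)
Require Import Defs.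
From mathcomp Require Import all_boot all_order all_algebra all_fingroup.
From mathcomp Require Import reals.
From mathcomp Require Import boolp.
From mathcomp Require Import zify ring.
Set Implicit Arguments. Unset Strict Implicit. Unset Printing Implicit Defensive.
Import Order.TTheory GRing.Theory Num.Theory.
Local Open Scope nat_scope.

(** * A union-free Hales-Jewett theorem *)

Section Templates.
Variables J T : finType.

Definition template := {ffun J -> option T}.

Definition active (t : template) (j : J) : bool := ~~ isSome (t j).

Definition fill (t : template) (w : J -> T) : {ffun J -> T} :=
  [ffun j => odflt (w j) (t j)].

Definition line_point (t : template) (y : T) : {ffun J -> T} := fill t (fun=> y).

Definition letters_in (ls : seq T) (t : template) :=
  forall j y, t j = Some y -> y \in ls.

(* In terms of indicator functions: within [D], the active set of [t2] is the disjoint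
   union of those of [t0] and [t1]. *)
Definition active_union_on (D : pred J) (t0 t1 t2 : template) :=
  forall j, D j -> active t2 j = active t0 j + active t1 j :> nat.

Definition union_free_on (D : pred J) (Lines : {set template}) :=
  forall t0 t1 t2, t0 \in Lines -> t1 \in Lines -> t2 \in Lines ->
    ~ active_union_on D t0 t1 t2.

End Templates.

Record union_free_HJ_lines (T C J : finType) (ls : seq T) (Lines : {set template J T}) :
    Prop := UnionFreeHJLines {
  HJ_letters : forall t, t \in Lines -> letters_in ls t;
  HJ_active : forall t, t \in Lines -> exists j, active t j;
  HJ_union_free : union_free_on predT Lines;
  HJ_monochromatic : forall c : {ffun J -> T} -> C, exists2 t, t \in Lines &
    {in ls &, forall y y', c (line_point t y) = c (line_point t y')} }.

Definition union_free_HJ (T : finType) (ls : seq T) :=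
  forall C : finType, exists (J : finType) (Lines : {set template J T}),
    union_free_HJ_lines C ls Lines.

Lemma union_free_HJ_eq_mem (T : finType) (ls ls' : seq T) :
  ls =i ls' -> union_free_HJ ls -> union_free_HJ ls'.
Proof.
move=> eq_ls HJ C; have [J [Lines [letters act uf mono]]] := HJ C.
exists J, Lines; split=> // [t tL j y ty|c].
  by rewrite -eq_ls; apply: letters tL j y ty.
have [t tL tmono] := mono c; exists t => // y y'; rewrite -!eq_ls; exact: tmono.
Qed.

Lemma union_free_HJ_small (T : finType) (ls : seq T) : size ls <= 1 -> union_free_HJ ls.
Proof.
move=> sz C; exists unit, [set [ffun=> None]]; split.
- by move=> t /set1P -> j y; rewrite ffunE.
- by move=> t /set1P ->; exists tt; rewrite /active ffunE.
- by move=> _ _ _ /set1P -> /set1P -> /set1P -> /(_ tt isT); rewrite /active ffunE.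
- move=> c; exists [ffun=> None] => [|y y']; first exact: set11.
  by case: ls sz => [|a [|b l]] //= _; rewrite !inE => /eqP -> /eqP ->.
Qed.

(* The chromatic number of the shift graph tends to infinity. *)
Lemma shift_pair_ramsey (C : finType) :
  exists n, forall g : 'I_n -> 'I_n -> C,
    exists x y z : 'I_n, [/\ x < y, y < z & g x y = g y z].
Proof.
pose n := #|{set C}|.+1; exists n => g.
pose row (x : 'I_n) := [set g x y | y : 'I_n & x < y].
have : ~~ injectiveb row.
  by apply/negP => /injectiveP /leq_card; rewrite card_ord ltnn.
move=> /injectivePn [x [y neq_xy eq_row]].
wlog lt_xy : x y neq_xy eq_row / x < y.
  move=> W; have [/W| /W|/val_inj eq_xy] := ltngtP x y; [exact| |].
    by rewrite eq_sym; exact.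
  by rewrite eq_xy eqxx in neq_xy.
have : g x y \in row x by apply: imset_f; rewrite inE.
by rewrite eq_row => /imsetP[z]; rewrite inE => lt_yz e; exists x, y, z.
Qed.

Section TwoLetters.
Variables (T : finType) (u v : T) (N : nat).

Definition interval_template (a b : nat) : template 'I_N T :=
  [ffun p : 'I_N => if p < a then Some u else if p < b then None else Some v].

Definition threshold_word (a : nat) : {ffun 'I_N -> T} :=
  [ffun p : 'I_N => if p < a then u else v].

Lemma active_interval_template a b p :
  active (interval_template a b) p = (a <= p < b).
Proof. by rewrite /active ffunE; case: ltnP => //= _; case: ltnP. Qed.

Lemma letters_interval_template a b : letters_in [:: u; v] (interval_template a b).
Proof.
by move=> p y; rewrite ffunE !inE; case: ifP => _; [|case: ifP => // _]; case=> ->;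
  rewrite eqxx ?orbT.
Qed.

Lemma interval_template_fst a b : a <= b ->
  line_point (interval_template a b) u = threshold_word b.
Proof.
move=> le_ab; apply/ffunP => p; rewrite !ffunE.
by case: ltnP => [lt_pa|_]; [rewrite (leq_trans lt_pa)|case: ifP].
Qed.

Lemma interval_template_snd a b :
  line_point (interval_template a b) v = threshold_word a.
Proof. by apply/ffunP => p; rewrite !ffunE; case: ifP => //; case: ifP. Qed.

Lemma adjacent_of_interval_union a0 b0 a1 b1 a2 b2 :
  a0 < b0 <= N -> a1 < b1 <= N -> a2 < b2 <= N -> a0 <= a1 ->
  active_union_on predT (interval_template a0 b0) (interval_template a1 b1)
    (interval_template a2 b2) ->
  [/\ a2 = a0, b0 = a1 & b1 = b2].
Proof.
move=> ab0 ab1 ab2 le_a U.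
have {}U p : p < N -> (a2 <= p < b2) = (a0 <= p < b0) + (a1 <= p < b1) :> nat.
  by move=> ltp; have := U (Ordinal ltp) isT; rewrite !active_interval_template.
have le_b0a1 : b0 <= a1 by have := U a1; lia.
have le_a2a0 : a2 <= a0 by have := U a0; lia.
have le_a0a2 : a0 <= a2 by have := U a2; lia.
have le_b1b2 : b1 <= b2 by have := U b1.-1; lia.
have le_a1b0 : a1 <= b0 by have := U b0; lia.
have le_b2b1 : b2 <= b1 by have := U b2.-1; lia.
by split; lia.
Qed.

End TwoLetters.

Section PairCode.
Variable n : nat.
Implicit Types x y z : 'I_n.

Definition pair_code x y := x * n + y.

Lemma pair_code_ub x y : pair_code x y < n * n.
Proof. by rewrite /pair_code; have := ltn_ord x; have := ltn_ord y; nia. Qed.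

Lemma pair_code_lt x y z : x < y -> pair_code x y < pair_code y z.
Proof. by rewrite /pair_code; have := ltn_ord y; nia. Qed.

Lemma pair_code_interval x y z : x < y -> pair_code x y < pair_code y z <= n * n.
Proof. by move=> lt_xy; rewrite pair_code_lt // ltnW // pair_code_ub. Qed.

Lemma pair_code_inj x y x' y' : pair_code x y = pair_code x' y' -> x = x' /\ y = y'.
Proof.
rewrite /pair_code => e; have n0 := leq_ltn_trans (leq0n x) (ltn_ord x).
have := congr1 (divn^~ n) e; have := congr1 (modn^~ n) e.
rewrite !modnMDl !divnMDl // !modn_small // !divn_small // !addn0.
by move=> /val_inj -> /val_inj ->.
Qed.

End PairCode.

Section ShiftTemplates.
Variables (T : finType) (u v : T) (n : nat).

Definition shift_template (x y z : 'I_n) : template 'I_(n * n) T :=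
  interval_template u v (n * n) (pair_code x y) (pair_code y z).

Definition shift_templates : {set template 'I_(n * n) T} :=
  [set shift_template i.1.1 i.1.2 i.2 | i : 'I_n * 'I_n * 'I_n & i.1.1 < i.1.2 < i.2].

Lemma shift_templatesP t :
  reflect (exists x y z : 'I_n, x < y < z /\ t = shift_template x y z)
    (t \in shift_templates).
Proof.
apply: (iffP imsetP) => [[[[x y] z] + ->]|[x [y [z [xyz ->]]]]].
  by rewrite inE; exists x, y, z.
by exists (x, y, z); rewrite ?inE.
Qed.

Lemma shift_templates_union_free : union_free_on predT shift_templates.
Proof.
move=> _ _ _ /shift_templatesP[x0 [y0 [z0 [/andP[xy0 _] ->]]]]
  /shift_templatesP[x1 [y1 [z1 [/andP[xy1 _] ->]]]]
  /shift_templatesP[x2 [y2 [z2 [/andP[xy2 _] ->]]]].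
wlog le01 : x0 y0 z0 xy0 x1 y1 z1 xy1 / pair_code x0 y0 <= pair_code x1 y1.
  move=> W; have [|/ltnW] := leqP (pair_code x0 y0) (pair_code x1 y1); first exact: W.
  by move=> /W {}W U; apply: W => // j /U ->; rewrite addnC.
move=> /(adjacent_of_interval_union (pair_code_interval z0 xy0)
  (pair_code_interval z1 xy1) (pair_code_interval z2 xy2) le01) [e2 e0 e1].
have [_ y20] := pair_code_inj e2; have [y0x1 _] := pair_code_inj e0.
have [y12 _] := pair_code_inj e1.
by move: xy1; rewrite -y0x1 y12 y20 ltnn.
Qed.

End ShiftTemplates.

(* The usual pigeonhole argument for two letters is replaced by the chromatic number of
   the shift graph: the active sets are intervals from the code of [(x, y)] to the code
   of [(y, z)], and no two adjacent ones have a union of the same form. *)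
Lemma union_free_HJ_pair (T : finType) (u v : T) : union_free_HJ [:: u; v].
Proof.
move=> C; have [n shift] := shift_pair_ramsey C.
exists 'I_(n * n), (shift_templates u v n); split.
- by move=> _ /shift_templatesP[x [y [z [_ ->]]]]; apply: letters_interval_template.
- move=> _ /shift_templatesP[x [y [z [/andP[xy _] ->]]]].
  exists (Ordinal (pair_code_ub x y)).
  by rewrite active_interval_template leqnn pair_code_lt.
- exact: shift_templates_union_free.
- move=> c; have [x [y [z [xy yz e]]]] :=
    shift (fun x y => c (threshold_word u v (n * n) (pair_code x y))).
  exists (shift_template u v x y z).
    by apply/shift_templatesP; exists x, y, z; rewrite xy.
  have eq_uv : c (line_point (shift_template u v x y z) u) =
               c (line_point (shift_template u v x y z) v).
    by rewrite interval_template_snd interval_template_fst ?e // ltnW ?pair_code_lt.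
  by move=> a b; rewrite !inE => /orP[] /eqP -> /orP[] /eqP ->.
Qed.

Definition ffun_sum (J1 J2 : finType) (U : Type) (f : {ffun J1 -> U}) (g : {ffun J2 -> U}) :
    {ffun J1 + J2 -> U} :=
  [ffun j => match j with inl j1 => f j1 | inr j2 => g j2 end].

Definition cons_block (J J1 B : Type) (beta : J -> B) (b : B) (j : J + J1) : B :=
  if j is inl j0 then beta j0 else b.

Lemma fill_ffun_sum (T J J1 : finType) (B : Type) (beta : J -> B) (b : B)
    (t : template J T) (t1 : template J1 T) (w : B -> T) :
  fill (ffun_sum t t1) (w \o cons_block beta b) =
  ffun_sum (fill t (w \o beta)) (line_point t1 (w b)).
Proof. by apply/ffunP => -[j|j]; rewrite !ffunE. Qed.

(* [beta] sends each coordinate to its block; Shelah's fusion of the letters [ls] makes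
   the colour independent of which of them is written into a block. *)
Record fused_blocks (T C J : finType) (ls : seq T) (B : eqType) (bs : seq B) (beta : J -> B)
    (Fam : {set template J T}) : Prop := FusedBlocks {
  fused_letters : forall t, t \in Fam -> letters_in ls t;
  fused_active : forall t b, t \in Fam -> b \in bs -> exists2 j, beta j = b & active t j;
  fused_union_free : forall b, b \in bs -> union_free_on (fun j => beta j == b) Fam;
  fused_color : forall c : {ffun J -> T} -> C, exists2 t, t \in Fam &
    forall w w' : B -> T,
      {in bs, forall b, w b = w' b \/ w b \in ls /\ w' b \in ls} ->
      c (fill t (w \o beta)) = c (fill t (w' \o beta)) }.

Lemma fused_blocks_nil (T C : finType) (ls : seq T) (B : eqType) :
  fused_blocks C ls [::] (@of_void B) [set: template void T].
Proof.
split=> // [t _ j|c]; first by case: (j).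
by exists [ffun=> None] => // w w' _; congr (c _); apply/ffunP; case.
Qed.

Lemma fused_blocks_cons (T C J J1 : finType) (ls : seq T) (B : eqType) (b : B) (bs : seq B)
    (beta : J -> B) (Fam : {set template J T}) (Lines : {set template J1 T}) :
  fused_blocks {ffun T -> C} ls bs beta Fam ->
  union_free_HJ_lines {ffun {ffun J -> T} -> C} ls Lines ->
  b \notin bs ->
  fused_blocks C ls (b :: bs) (cons_block beta b)
    [set ffun_sum t0 t1 | t0 in Fam, t1 in Lines].
Proof.
move=> [letters0 act0 uf0 color0] [letters1 act1 uf1 mono1] nb; split.
- move=> _ /imset2P[t0 t1 F0 F1 ->] [j|j] y; rewrite ffunE; first exact: letters0.
  exact: letters1.
- move=> _ b' /imset2P[t0 t1 F0 F1 ->]; rewrite inE => /orP[/eqP ->|b'bs].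
    by have [j aj] := act1 _ F1; exists (inr j); rewrite // /active ffunE.
  by have [j <- aj] := act0 _ _ F0 b'bs; exists (inl j); rewrite // /active ffunE.
- move=> b' b'bs _ _ _ /imset2P[f0 g0 F0 L0 ->] /imset2P[f1 g1 F1 L1 ->]
    /imset2P[f2 g2 F2 L2 ->] U.
  move: b'bs; rewrite inE => /orP[/eqP eb|b'bs].
    apply: (uf1 _ _ _ L0 L1 L2) => j _.
    by have := U (inr j); rewrite eb eqxx /active !ffunE; exact.
  apply: (uf0 _ b'bs _ _ _ F0 F1 F2) => j ej.
  by have := U (inl j) ej; rewrite /active !ffunE.
- move=> c.
  have [t1 L1 mono_t1] := mono1 (fun g => [ffun f => c (ffun_sum f g)]).
  have [t0 F0 color_t0] := color0 (fun f => [ffun y => c (ffun_sum f (line_point t1 y))]).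
  exists (ffun_sum t0 t1) => [|w w' ww']; first exact: imset2_f.
  have ww'_bs : {in bs, forall b', w b' = w' b' \/ w b' \in ls /\ w' b' \in ls}.
    by move=> b' b'bs; apply: ww'; rewrite inE b'bs orbT.
  have /ffunP/(_ (w b)) := color_t0 w w' ww'_bs; rewrite !fill_ffun_sum.
  rewrite !ffunE => ->; have [->//|[wb w'b]] := ww' b (mem_head _ _).
  by have /ffunP/(_ (fill t0 (w' \o beta))) := mono_t1 _ _ wb w'b; rewrite !ffunE.
Qed.

Lemma fused_blocks_exist (T C : finType) (ls : seq T) (B : eqType) (bs : seq B) :
  union_free_HJ ls -> uniq bs ->
  exists (J : finType) (beta : J -> B) (Fam : {set template J T}),
    fused_blocks C ls bs beta Fam.
Proof.
move=> HJ; elim: bs C => [|b bs IH] C.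
  by move=> _; do 3!eexists; apply: fused_blocks_nil.
case/andP=> nb /(IH {ffun T -> C}) [J [beta [Fam blocks]]].
have [J1 [Lines lines]] := HJ {ffun {ffun J -> T} -> C}.
by do 3!eexists; apply: fused_blocks_cons blocks lines nb.
Qed.

Definition nest (T J J0 : finType) (beta : J -> J0) (t : template J T)
    (t0 : template J0 T) : template J T :=
  [ffun j => if t j is Some y then Some y else t0 (beta j)].

Section Nest.
Variables (T J J0 : finType) (beta : J -> J0) (t : template J T) (t0 : template J0 T).

Lemma active_nest j : active (nest beta t t0) j = active t j && active t0 (beta j).
Proof. by rewrite /active ffunE; case: (t j). Qed.

Lemma line_point_nest y : line_point (nest beta t t0) y = fill t (line_point t0 y \o beta).
Proof. by apply/ffunP => j; rewrite !ffunE; case: (t j) => //=; rewrite ffunE. Qed.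

End Nest.

Lemma union_free_nest (T C J J0 : finType) (ls : seq T) (beta : J -> J0)
    (Fam : {set template J T}) (Lines : {set template J0 T}) :
  fused_blocks C ls (enum J0) beta Fam -> union_free_on predT Lines ->
  union_free_on predT [set nest beta t t0 | t in Fam, t0 in Lines].
Proof.
move=> [_ act uf _] uf0.
move=> _ _ _ /imset2P[f0 t0 F0 L0 ->] /imset2P[f1 t1 F1 L1 ->] /imset2P[f2 t2 F2 L2 ->] U.
have inJ0 b : b \in enum J0 by rewrite mem_enum.
apply: (uf0 _ _ _ L0 L1 L2) => b _.
have [j0 e0 a0] := act _ _ F0 (inJ0 b); have [j1 e1 a1] := act _ _ F1 (inJ0 b).
have [j2 e2 a2] := act _ _ F2 (inJ0 b).
have [/and3P[A0 A1 A2]|] := boolP [&& active t0 b, active t1 b & active t2 b].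
  exfalso; apply: (uf _ (inJ0 b) _ _ _ F0 F1 F2) => j /eqP ej.
  by have := U j isT; rewrite !active_nest ej A0 A1 A2 !andbT.
have := U j0 isT; have := U j1 isT; have := U j2 isT.
rewrite !active_nest e0 e1 e2 a0 a1 a2 /= {U}.
by do !case: (active _ _).
Qed.

Lemma union_free_HJ_cat (T : finType) (ls ls' : seq T) (u : T) :
  u \in ls -> u \in ls' -> union_free_HJ ls -> union_free_HJ ls' ->
  union_free_HJ (ls ++ ls').
Proof.
move=> u_ls u_ls' HJ HJ' C.
have [J0 [Lines [letters' act' uf' mono']]] := HJ' C.
have [J [beta [Fam blocks]]] := fused_blocks_exist C HJ (enum_uniq J0).
have [letters act _ color] := blocks.
exists J, [set nest beta t t0 | t in Fam, t0 in Lines]; split.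
- move=> _ /imset2P[t t0 Ft Lt0 ->] j y; rewrite ffunE mem_cat.
  case e: (t j) => [y'|].
    by case=> <-; rewrite (letters _ Ft _ _ e).
  by move=> /(letters' _ Lt0) ->; rewrite orbT.
- move=> _ /imset2P[t t0 Ft Lt0 ->]; have [b ab] := act' _ Lt0.
  have [|j ej aj] := act t b Ft; first by rewrite mem_enum.
  by exists j; rewrite active_nest aj ej.
- exact: union_free_nest blocks uf'.
- move=> c; have [t Ft color_t] := color c.
  have [t0 Lt0 mono_t0] := mono' (fun w => c (fill t (w \o beta))).
  exists (nest beta t t0); first exact: imset2_f.
  have to_u y : y \in ls ++ ls' ->
      c (line_point (nest beta t t0) y) = c (line_point (nest beta t t0) u).
    rewrite mem_cat !line_point_nest => /orP[y_ls|y_ls']; last exact: mono_t0.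
    by apply: color_t => b _; rewrite !ffunE; case: (t0 b) => [a|]; [left|right].
  by move=> y y' /to_u -> /to_u ->.
Qed.

Lemma union_free_hales_jewett (T : finType) (ls : seq T) : union_free_HJ ls.
Proof.
elim: ls => [|v [|u ls] IH]; [exact: union_free_HJ_small|exact: union_free_HJ_small|].
apply: (@union_free_HJ_eq_mem _ ([:: v; u] ++ (u :: ls))).
  by move=> x; rewrite !inE; case: (x == u); rewrite ?orbT.
apply: (@union_free_HJ_cat _ _ _ u); rewrite ?inE ?eqxx ?orbT //.
exact: union_free_HJ_pair.
Qed.

(** * Ramsey's theorem and random orders *)

Definition homogeneous (T : eqType) (C : Type) (m : nat) (c : seq T -> C) (t : seq T) :=
  forall a b, subseq a t -> subseq b t -> size a = m -> size b = m -> c a = c b.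

Definition ramsey_number_exists (C : finType) (m M : nat) :=
  exists n, forall (T : eqType) (s : seq T) (c : seq T -> C), uniq s -> n <= size s ->
    exists t, [/\ subseq t s, size t = M & homogeneous m c t].

Lemma size_sum_fibres (T I : eqType) (g : T -> I) (r : seq I) (s : seq T) :
  uniq r -> {in s, forall x, g x \in r} ->
  size s = \sum_(a <- r) count (fun x => g x == a) s.
Proof.
move=> ur g_r; under eq_bigr do rewrite -sum1_count big_mkcond.
rewrite exchange_big -sum1_size [LHS]big_seq [RHS]big_seq; apply: eq_bigr => x /g_r xr /=.
rewrite -big_mkcond sum1_count (@eq_count _ _ (pred1 (g x))).
  by rewrite count_uniq_mem // xr.
by move=> a; rewrite /= eq_sym.
Qed.

Lemma pigeonhole_count (T : eqType) (C : finType) (g : T -> C) (s : seq T) M :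
  #|C| * M < size s -> exists a, M <= count (fun x => g x == a) s.
Proof.
move=> lt; apply/existsP; apply: contraLR lt; rewrite negb_exists => /forallP few.
rewrite -leqNgt (size_sum_fibres (index_enum_uniq C) (g := g)) => [|x _]; last first.
  exact: mem_index_enum.
by rewrite -sum_nat_const; apply: leq_sum => a _; apply: ltnW; rewrite ltnNge.
Qed.

Lemma min_determined_subseq (C : finType) (m : nat) :
  (forall M, ramsey_number_exists C m M) ->
  forall L, exists n, forall (T : eqType) (s : seq T) (c : seq T -> C),
    uniq s -> n <= size s -> exists t (g : T -> C), [/\ subseq t s, size t = L &
      forall x a, subseq (x :: a) t -> size a = m -> c (x :: a) = g x].
Proof.
move=> ramsey_m; elim=> [|L [n' IH]].
  exists 0 => T s c _ _; exists [::], (fun x => c [:: x]).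
  by split; rewrite ?sub0seq.
have [n hom_n] := ramsey_m n'; exists n.+1 => T [|x s] c //= /andP[nx us] le.
have [t1 [st1 sz1 hom1]] := hom_n T s (fun a => c (x :: a)) us le.
have [t2 [g [st2 sz2 g_t2]]] := IH T t1 c (subseq_uniq st1 us) (eq_leq (esym sz1)).
exists (x :: t2), (fun y => if y == x then c (x :: take m t1) else g y).
split; rewrite /= ?eqxx ?sz2 ?(subseq_trans st2) //.
move=> y a; case: eqP => [-> sa sz|_ sa sz]; last exact: g_t2.
have sa1 := subseq_trans sa st2.
apply: hom1; rewrite ?take_subseq // size_takel // -sz; exact: size_subseq.
Qed.

Lemma finite_ramsey (C : finType) (m M : nat) : ramsey_number_exists C m M.
Proof.
elim: m M => [|m IH] M.
  exists M => T s c _ le; exists (take M s); split; rewrite ?take_subseq ?size_takel //.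
  by move=> a b _ _ /size0nil -> /size0nil ->.
have [n min_det_n] := min_determined_subseq IH (#|C| * M).+1; exists n => T s c us le.
have [t [g [st sz g_t]]] := min_det_n T s c us le.
have [|a le_count] := @pigeonhole_count _ _ g t M; first by rewrite sz.
pose t' := [seq x <- t | g x == a]; exists (take M t'); split.
- exact: subseq_trans (take_subseq _ _) (subseq_trans (filter_subseq _ _) st).
- by rewrite size_takel // size_filter.
have color_a b : subseq b (take M t') -> size b = m.+1 -> c b = a.
  case: b => // x b sb [sz_b]; have {}sb := subseq_trans sb (take_subseq _ _).
  rewrite (g_t x b) ?(subseq_trans sb) ?filter_subseq //.
  by have := mem_subseq sb (mem_head x b); rewrite mem_filter => /andP[/eqP].
by move=> b b' sb sb' sz_b sz_b'; rewrite !color_a.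
Qed.

Lemma finite_ramsey_set (C : finType) (m M : nat) :
  exists n, forall (T : finType) (c : {set T} -> C), n <= #|T| ->
    exists2 S : {set T}, #|S| = M & forall A B : {set T}, A \subset S -> B \subset S ->
      #|A| = m -> #|B| = m -> c A = c B.
Proof.
have [n ramsey_n] := finite_ramsey C m M; exists n => T c le.
have [|t [st sz hom]] := ramsey_n _ (enum T) (fun a => c [set x in a]) (enum_uniq _).
  by rewrite -cardE.
have ut := subseq_uniq st (enum_uniq T).
exists [set x in t]; first by rewrite cardsE (card_uniqP ut).
have as_subseq (A : {set T}) : A \subset [set x in t] ->
    A = [set x in [seq x <- t | x \in A]].
  move=> /subsetP At; apply/setP => x; rewrite inE mem_filter andb_idr //.
  by move=> /At; rewrite inE.
move=> A B At Bt cA cB; rewrite (as_subseq A At) (as_subseq B Bt).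
have size_filter_set (D : {set T}) : D \subset [set x in t] ->
    size [seq x <- t | x \in D] = #|D|.
  by move=> /as_subseq {2}->; rewrite cardsE (card_uniqP (filter_uniq _ ut)).
by apply: hom; rewrite ?filter_subseq ?size_filter_set.
Qed.

Lemma card_ord_interval M a b : b <= M -> #|[set q : 'I_M | a <= q < b]| = b - a.
Proof.
move=> le_bM; rewrite -sum1dep_card -(big_mkord (fun q => a <= q < b) (fun=> 1)).
rewrite -[RHS]muln1 -sum_nat_const_nat (big_nat_widen _ _ _ _ _ le_bM).
by rewrite (big_nat_widenl _ _ _ _ _ (leq0n a)); apply: eq_bigl => q; rewrite andbC.
Qed.

Definition increasing M n (u : {ffun 'I_M -> 'I_n}) :=
  [forall p : 'I_M, forall q : 'I_M, (p < q) ==> (u p < u q)].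

Lemma increasingP M n (u : {ffun 'I_M -> 'I_n}) :
  reflect {homo u : p q / p < q} (increasing u).
Proof.
apply: (iffP forallP) => [inc p q pq|inc p].
  by have /forallP/(_ q)/implyP := inc p; apply.
by apply/forallP => q; apply/implyP; apply: inc.
Qed.

Lemma increasing_enum n (S : {set 'I_n}) :
  exists2 u : {ffun 'I_#|S| -> 'I_n}, increasing u & u @: setT = S.
Proof.
exists [ffun p => Order.enum_val p].
  apply/increasingP => p q; rewrite !ffunE.
  exact: (mono2W (leW_mono (@Order.EnumVal.le_enum_val _ 'I_n le_total (mem S)))) p q.
apply/setP => x; apply/imsetP/idP => [[p _ ->]|xS].
  by rewrite ffunE Order.EnumVal.enum_valP.
by exists (Order.enum_rank_in xS x); rewrite // ffunE Order.EnumVal.enum_rankK_in.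
Qed.

Definition position n (S : {set 'I_n}) (x : 'I_n) := #|[set y in S | y < x]|.

Section Increasing.
Variables (M n : nat) (u : {ffun 'I_M -> 'I_n}).
Hypothesis incu : increasing u.

Lemma increasing_mono : {mono u : p q / p < q}.
Proof. exact: leW_mono (le_mono (increasingP _ incu)). Qed.

Lemma increasing_inj : injective u.
Proof. exact: inc_inj (le_mono (increasingP _ incu)). Qed.

Lemma position_imset (A : {set 'I_M}) (p : 'I_M) :
  position (u @: A) (u p) = #|[set q in A | q < p]|.
Proof.
rewrite /position -(card_imset _ increasing_inj); apply: eq_card => y.
rewrite inE; apply/andP/imsetP => [[/imsetP[q qA ->]]|[q + ->]].
  by rewrite increasing_mono => qp; exists q; rewrite // inE qA.
by rewrite inE increasing_mono => /andP[qA]; rewrite imset_f.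
Qed.

Lemma position_range (p : 'I_M) : position (u @: setT) (u p) = p.
Proof.
rewrite position_imset -[RHS]subn0 -(card_ord_interval 0 (ltnW (ltn_ord p))).
by apply: eq_card => q; rewrite !inE.
Qed.

End Increasing.

Lemma increasing_range_inj M n (u u' : {ffun 'I_M -> 'I_n}) :
  increasing u -> increasing u' -> u @: setT = u' @: setT -> u = u'.
Proof.
move=> iu iu' e; apply/ffunP => p.
have : u p \in u' @: setT by rewrite -e imset_f ?inE.
case/imsetP => q _ eq_pq; rewrite eq_pq; congr (u' _); apply: ord_inj.
by rewrite -(position_range iu') -eq_pq -e position_range.
Qed.

Lemma card_position n (S : {set 'I_n}) (P : pred nat) :
  #|[set p : 'I_#|S| | P p]| <= #|[set x in S | P (position S x)]|.
Proof.
have [u iu uS] := increasing_enum S.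
rewrite -(card_imset _ (increasing_inj iu)); apply/subset_leq_card/subsetP.
move=> _ /imsetP[p + ->]; rewrite !inE; have := position_range iu p.
by have := imset_f u (in_setT p); rewrite uS => -> ->.
Qed.

Section ArgMin.
Variables (n : nat) (S : {set 'I_n}).
Implicit Type sg : 'S_n.

Definition is_argmin sg x := (x \in S) && [forall y in S, sg x <= sg y].

Lemma is_argmin_uniq sg x y : is_argmin sg x -> is_argmin sg y -> x = y.
Proof.
case/andP=> xS /forall_inP x_min /andP[yS /forall_inP y_min].
by apply/(@perm_inj _ sg)/val_inj/eqP; rewrite eqn_leq x_min ?y_min.
Qed.

Lemma is_argmin_exists sg x0 : x0 \in S -> exists x, is_argmin sg x.
Proof.
move=> x0S; case: (arg_minnP (fun x => val (sg x)) x0S) => x xS le_x.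
by exists x; apply/andP; split; last apply/forall_inP.
Qed.

Lemma card_is_argmin x y : x \in S -> y \in S ->
  #|[set sg | is_argmin sg x]| = #|[set sg | is_argmin sg y]|.
Proof.
wlog suff W : x y / x \in S -> y \in S ->
    #|[set sg | is_argmin sg x]| <= #|[set sg | is_argmin sg y]|.
  by move=> xS yS; apply/eqP; rewrite eqn_leq !W.
move=> xS yS; rewrite -(card_imset _ (mulgI (tperm x y))).
apply: subset_leq_card; apply/subsetP => _ /imsetP[sg + ->].
rewrite !inE => /andP[_ /forall_inP x_min]; rewrite /is_argmin yS /=.
apply/forall_inP => z zS; rewrite !permM tpermR; apply: x_min.
by case: tpermP.
Qed.

Lemma card_argmin_in_sum (U : {set 'I_n}) :
  #|[set sg | [exists x in U, is_argmin sg x]]| =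
  \sum_(x in U) #|[set sg | is_argmin sg x]|.
Proof.
under [RHS]eq_bigr do rewrite -sum1dep_card big_mkcond /=.
rewrite exchange_big -sum1dep_card big_mkcond /=; apply: eq_bigr => sg _.
case: existsP => [[x /andP[xU ax]]|none].
  rewrite (bigD1 x) //= ax big1 // => y /andP[_ ne_yx]; case: ifP => // ay.
  by rewrite (is_argmin_uniq ax ay) eqxx in ne_yx.
by rewrite big1 // => y yU; case: ifP => // ay; case: none; exists y; rewrite yU.
Qed.

Lemma card_argmin_in (U : {set 'I_n}) : U \subset S ->
  #|S| * #|[set sg | [exists x in U, is_argmin sg x]]| = #|U| * #|{: 'S_n}|.
Proof.
case: (set_0Vmem S) => [->|[x0 x0S] US].
  by rewrite subset0 => /eqP ->; rewrite cards0.
have card_sub (D : {set 'I_n}) : D \subset S ->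
    #|[set sg | [exists x in D, is_argmin sg x]]| = #|D| * #|[set sg | is_argmin sg x0]|.
  move=> /subsetP DS; rewrite card_argmin_in_sum -sum_nat_const.
  by apply: eq_bigr => x /DS xS; apply: card_is_argmin.
rewrite card_sub // mulnCA -card_sub //; congr (_ * _); apply: eq_card => sg.
rewrite !inE; apply/existsP; have [x ax] := is_argmin_exists sg x0S.
by exists x; rewrite ax andbT; case/andP: ax.
Qed.

End ArgMin.

(** * A linear hypergraph with dense random independent sets *)

Definition is_const (S T : Type) (f : S -> T) := forall s t, f s = f t.

Definition dense_selection (R : realType) (mu : R) (Om : finType) (T : Type)
    (sel : Om -> T -> bool) (pT : predType T) (D : pT) :=
  0 < #|Om| /\ {in D, forall x, mu * #|Om|%:R <= #|[set om | sel om x]|%:R}%R.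

Section OmittedPositions.
Variables k w : nat.
Hypothesis k_gt1 : 1 < k.

(* A window of [k] rows of length [k], a middle part, and a second window of [k] rows of
   length [k]; the [s]-th vertex omits positions from the [s]-th row of either window. *)
Definition late_start := k * k + k * w + k.
Definition width := late_start + k * k.

Definition early_omitted (s : 'I_k) : {set 'I_width} :=
  [set q : 'I_width | s * k <= q < s * k + s].
Definition late_omitted (s : 'I_k) : {set 'I_width} :=
  [set q : 'I_width | late_start + s * k <= q < late_start + s * k + (k - 1 - s)].
Definition omitted (s : 'I_k) := early_omitted s :|: late_omitted s.

Lemma row_end_bound (s : 'I_k) : s * k + k <= k * k.
Proof. by have := ltn_ord s; nia. Qed.

Lemma row_index_inj (s t : 'I_k) x :
  s * k <= x < s * k + k -> t * k <= x < t * k + k -> s = t.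
Proof. by move=> row_s row_t; apply: ord_inj; clear -row_s row_t; nia. Qed.

Lemma omitted_disjoint (s t : 'I_k) q : q \in omitted s -> q \in omitted t -> s = t.
Proof.
have [row_s row_t] := (row_end_bound s, row_end_bound t).
have [lt_s lt_t] := (ltn_ord s, ltn_ord t).
rewrite !inE => /orP[in_s|in_s] /orP[in_t|in_t].
- by apply: (@row_index_inj _ _ q); lia.
- by exfalso; rewrite /late_start in in_t; lia.
- by exfalso; rewrite /late_start in in_s; lia.
- by apply: (@row_index_inj _ _ (q - late_start)); lia.
Qed.

Lemma omitted_setI (s t : 'I_k) : s != t -> omitted s :&: omitted t = set0.
Proof.
move=> neq_st; apply/setP => q; rewrite in_setI in_set0; apply/negP => /andP[qs qt].
by rewrite (omitted_disjoint qs qt) eqxx in neq_st.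
Qed.

Lemma exists_not_omitted (q : 'I_width) : exists s, q \notin omitted s.
Proof.
pose s0 := Ordinal (ltnW k_gt1); pose s1 := Ordinal k_gt1.
have [q0|] := boolP (q \in omitted s0); last by exists s0.
by exists s1; apply/negP => /(omitted_disjoint q0).
Qed.

Lemma omitted_middle (s : 'I_k) (q : 'I_width) :
  k * k <= q < late_start -> q \notin omitted s.
Proof.
by move=> mid_q; have row_s := row_end_bound s; have lt_s := ltn_ord s; rewrite !inE; lia.
Qed.

Lemma card_early_omitted (s : 'I_k) : #|early_omitted s| = s.
Proof.
have row_s := row_end_bound s; have lt_s := ltn_ord s.
by rewrite card_ord_interval ?addKn // /width /late_start; lia.
Qed.

Lemma card_omitted (s : 'I_k) : #|omitted s| = k.-1.
Proof.
have row_s := row_end_bound s; have lt_s := ltn_ord s.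
rewrite cardsU disjoint_setI0 ?cards0; last first.
  by rewrite -setI_eq0; apply/eqP/setP => q; rewrite !inE /late_start; lia.
by rewrite card_early_omitted card_ord_interval /width; lia.
Qed.

Lemma card_omitted_lt_middle (s : 'I_k) (p : 'I_width) :
  k * k <= p < late_start -> #|[set q in omitted s | q < p]| = s.
Proof.
move=> mid_p; have row_s := row_end_bound s; have lt_s := ltn_ord s.
by rewrite -[RHS]card_early_omitted; apply: eq_card => q; rewrite !inE; lia.
Qed.

Definition good_position p := (k * k <= p < k * k + k * w) && ~~ (k %| p).

Lemma card_good_position m : k * k + k * w <= m ->
  w * k.-1 <= #|[set p : 'I_m | good_position p]|.
Proof.
move=> le_m; have k_gt0 : 0 < k by apply: ltnW.
have lt_predk (i : 'I_k.-1) : i.+1 < k by have := ltn_ord i; lia.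
have pos_lt (x : 'I_w * 'I_k.-1) : (k + x.1) * k + x.2.+1 < k * k + k * w.
  by have := ltn_ord x.1; have := lt_predk x.2; nia.
pose pos x : 'I_m := Ordinal (leq_trans (pos_lt x) le_m).
have pos_inj : injective pos.
  move=> [a b] [a' b'] /(congr1 val) /= e.
  have := congr1 (divn^~ k) e; have := congr1 (modn^~ k) e.
  rewrite !modnMDl !divnMDl // !modn_small // !divn_small // !addn0.
  by move=> /succn_inj /val_inj -> /addnI /val_inj ->.
rewrite -[w]card_ord -[k.-1 in X in X <= _]card_ord -card_prod -cardsT.
rewrite -(card_imset _ pos_inj); apply/subset_leq_card/subsetP => _ /imsetP[x _ ->].
rewrite inE /good_position [nat_of_ord _]/= pos_lt dvdn_addr ?dvdn_mull //.
by rewrite gtnNdvd // mulnDl -addnA leq_addr.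
Qed.

Section Vertices.
Variable n : nat.
Implicit Types (u : {ffun 'I_width -> 'I_n}) (sg : 'S_n) (S : {set 'I_n}).

Definition vertex u s : {set 'I_n} := u @: (~: omitted s).

Definition vertex_size := 2 * (k * k) + 1 + k * w.

Definition selected sg S :=
  [exists x in [set x in S | good_position (position S x)], is_argmin S sg x].

Lemma vertex_inj u : increasing u -> injective (vertex u).
Proof.
move=> iu s t /(imset_inj (increasing_inj iu)) /setC_inj e.
have : 0 < #|omitted s| by rewrite card_omitted; lia.
by case/card_gt0P => q qs; apply: (omitted_disjoint qs); rewrite -e.
Qed.

Lemma vertexU u s t : s != t -> vertex u s :|: vertex u t = u @: setT.
Proof. by move=> neq_st; rewrite /vertex -imsetU -setCI omitted_setI ?setC0. Qed.

Lemma vertex_linear u u' s t s' t' : increasing u -> increasing u' -> s != t ->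
  vertex u s = vertex u' s' -> vertex u t = vertex u' t' -> u = u'.
Proof.
move=> iu iu' neq_st es et; apply: increasing_range_inj => //.
have neq_st' : s' != t'.
  by apply: contra_neq neq_st => e; apply: (vertex_inj iu); rewrite es et e.
by rewrite -(vertexU u neq_st) -(vertexU u' neq_st') es et.
Qed.

Lemma card_vertex u s : increasing u -> #|vertex u s| = vertex_size.
Proof.
move=> iu; rewrite (card_imset _ (increasing_inj iu)) cardsCs setCK card_ord card_omitted.
by rewrite /vertex_size /width /late_start; lia.
Qed.

Lemma position_vertex u s (p : 'I_width) : increasing u ->
  position (vertex u s) (u p) + #|[set q in omitted s | q < p]| = p.
Proof.
move=> iu; rewrite position_imset // -[RHS](position_range iu) position_imset //.
rewrite -(cardsID (omitted s) [set q : 'I_width in setT | q < p]) addnC.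
by congr (_ + _); apply: eq_card => q; rewrite !inE andbC.
Qed.

Lemma selected_position u sg s (p : 'I_width) :
  increasing u -> (forall q, sg (u p) <= sg (u q)) ->
  selected sg (vertex u s) -> p \notin omitted s ->
  good_position (position (vertex u s) (u p)).
Proof.
move=> iu pmin /existsP[x /andP[+ ax]] ps; rewrite inE => /andP[_].
rewrite (is_argmin_uniq ax (_ : is_argmin _ _ (u p))) //; apply/andP; split.
  by apply: imset_f; rewrite inE.
by apply/forall_inP => _ /imsetP[q _ ->].
Qed.

(* If the minimum over the whole sequence [u] is attained at a middle position [p], then
   it has position [p - s] in the [s]-th vertex, so the vertex with [s = p %% k] is not
   selected. *)
Lemma selected_independent u sg : increasing u -> ~ (forall s, selected sg (vertex u s)).
Proof.
move=> iu sel; have width_gt0 : 0 < width by rewrite /width /late_start; lia.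
have p0 : 'I_width := Ordinal width_gt0.
have [p _ pmin] := arg_minnP (fun p => val (sg (u p))) (erefl : xpredT p0).
have good s : p \notin omitted s -> good_position (position (vertex u s) (u p)).
  exact: selected_position iu (fun q => pmin q isT) (sel s).
have middle_p : k * k <= p < late_start.
  have [s ps] := exists_not_omitted p; have /andP[le_p _] := good s ps.
  have := position_vertex s p iu.
  have : #|[set q in omitted s | q < p]| <= k.-1.
    rewrite -(card_omitted s); apply/subset_leq_card/subsetP => q.
    by rewrite inE => /andP[].
  by rewrite /late_start; lia.
pose t := Ordinal (ltn_pmod p (ltnW k_gt1)).
have /andP[_ /negP] := good t (omitted_middle t middle_p); apply.
have := position_vertex t p iu; rewrite (card_omitted_lt_middle t middle_p) /=.
move: (position _ _) => c; rewrite [RHS](divn_eq p k) => /addIn ->.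
exact: dvdn_mull.
Qed.

Lemma selected_density S : #|S| = vertex_size ->
  w * k.-1 * #|{: 'S_n}| <= vertex_size * #|[set sg | selected sg S]|.
Proof.
move=> cS; rewrite -{1}cS card_argmin_in; last first.
  by apply/subsetP => x; rewrite inE => /andP[].
rewrite leq_mul2r; apply/orP; right; apply: leq_trans (card_position _ _).
by apply: card_good_position; rewrite cS /vertex_size; lia.
Qed.

Definition vertex_selection sg S := (#|S| == vertex_size) ==> selected sg S.

Lemma dense_vertex_selection (R : realType) (mu : R) :
  (mu <= 1)%R -> (mu * vertex_size%:R <= w%:R * (k%:R - 1))%R ->
  dense_selection mu vertex_selection predT.
Proof.
move=> mu_le1 mu_le; split=> [|S _]; first by apply/card_gt0P; exists 1%g.
rewrite /vertex_selection; have [cS|_] /= := eqVneq #|S| vertex_size; last first.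
  have -> : [set sg : 'S_n | true] = setT by apply/setP => sg; rewrite !inE.
  by rewrite cardsT ler_piMl.
have size_gt0 : (0 < vertex_size%:R :> R)%R by rewrite ltr0n /vertex_size addn1.
rewrite -(ler_pM2l size_gt0); have := selected_density cS.
rewrite -(ler_nat R) !natrM; apply: le_trans.
by rewrite mulrA ler_wpM2r // mulrC -subn1 natrB // ltnW.
Qed.

End Vertices.

Lemma vertex_ramsey (C : finType) : exists n, forall c : {set 'I_n} -> C,
  exists2 u : {ffun 'I_width -> 'I_n}, increasing u & is_const (c \o vertex u).
Proof.
have [n ramsey_n] := finite_ramsey_set C vertex_size width.
exists n => c; have [|S cS hom] := ramsey_n _ c; first by rewrite card_ord.
have [u] := increasing_enum S; move: u; rewrite cS => u iu uS.
exists u => // s t; apply: hom; rewrite ?card_vertex // -uS; exact/imsetS/subsetT.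
Qed.

End OmittedPositions.

Definition uniform_edges (K V E : Type) (v : E -> K -> V) := forall e, injective (v e).

Definition linear_edges (K : eqType) (V E : Type) (v : E -> K -> V) :=
  forall e e' s t s' t', s != t -> v e s = v e' s' -> v e t = v e' t' -> e = e'.

Lemma linear_ratio_reached (R : realType) (mu b : R) (a k : nat) :
  (mu * k%:R < b)%R -> exists w : nat, (mu * (a + k * w)%:R <= w%:R * b)%R.
Proof.
rewrite -subr_gt0; set gap := (b - _)%R => gap_gt0.
exists (Num.bound `|mu * a%:R / gap|%R); set w := Num.bound _.
have le_w : (mu * a%:R <= w%:R * gap)%R.
  rewrite -ler_pdivrMr // (le_trans (ler_norm _)) // ltW //.
  by rewrite archi_boundP ?normr_ge0.
rewrite natrD natrM mulrDr -lerBrDr (le_trans le_w) // le_eqVlt.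
by apply/orP; left; apply/eqP; rewrite /gap; ring.
Qed.

Lemma sparse_hypergraph (R : realType) (K C : finType) (mu : R) : 1 < #|K| ->
  (mu < (#|K|%:R - 1) / #|K|%:R)%R ->
  exists (V E Om : finType) (v : E -> K -> V) (sel : Om -> V -> bool),
  [/\ uniform_edges v, linear_edges v,
      forall c : V -> C, exists e, is_const (c \o v e),
      forall om e, ~ (forall s, sel om (v e s)) &
      dense_selection mu sel predT].
Proof.
set k := #|K| => k_gt1 mu_lt.
have k_gt0 : (0 < k%:R :> R)%R by rewrite ltr0n ltnW.
have mu_le1 : (mu <= 1)%R.
  by rewrite ltW // (lt_trans mu_lt) // ltr_pdivrMr // mul1r gtrBl.
have [|w mu_le] := @linear_ratio_reached R mu (k%:R - 1) (2 * (k * k) + 1) k.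
  by rewrite -ltr_pdivlMr.
have [n ramsey_n] := vertex_ramsey w k_gt1 C.
pose E := {u : {ffun 'I_(width k w) -> 'I_n} | increasing u}.
pose v (e : E) (s : K) := vertex (val e) (enum_rank s).
exists {set 'I_n}, E, 'S_n, v, (@vertex_selection k w n); split.
- by move=> e s t /(vertex_inj k_gt1 (valP e)) /enum_rank_inj.
- move=> e e' s t s' t' neq_st es et; apply: val_inj.
  apply: (vertex_linear k_gt1 (valP e) (valP e') _ es et).
  by rewrite (inj_eq enum_rank_inj).
- by move=> c; have [u iu mono_u] := ramsey_n c; exists (Sub u iu) => s t; apply: mono_u.
- move=> sg e sel; apply: (selected_independent k_gt1 (valP e) (sg := sg)) => s.
  have := sel (enum_val s).
  by rewrite /v enum_valK /vertex_selection card_vertex ?(valP e) ?eqxx.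
- exact: dense_vertex_selection.
Qed.

(** * The partite construction *)

Definition const_or_inj (S T : Type) (f : S -> T) := is_const f \/ injective f.

Definition quasiline (K I : finType) (y : K -> {ffun I -> K}) :=
  (forall i, const_or_inj (fun s => y s i)) /\ exists i, injective (fun s => y s i).

Lemma quasiline_or_const (K I : finType) (y : K -> {ffun I -> K}) :
  (forall i, const_or_inj (fun s => y s i)) -> quasiline y \/ is_const y.
Proof.
move=> ci; have [inj|noninj] := pselect (exists i, injective (fun s => y s i)).
  by left.
right=> s t; apply/ffunP => i; have [cst|inj] := ci i; first exact: cst.
by case: noninj; exists i.
Qed.

Lemma exists_third (K : finType) (s t : K) : 2 < #|K| -> exists2 x, x != s & x != t.
Proof.
move=> K_gt2; have [x] : exists x, x \in ~: [set s; t].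
  apply/card_gt0P; rewrite cardsCs setCK subn_gt0.
  by apply: leq_ltn_trans K_gt2; rewrite cards2; case: (s != t).
by rewrite !inE negb_or => /andP[]; exists x.
Qed.

Section Edges.
Variables (K : finType) (V : eqType) (E : Type) (v : E -> K -> V).
Hypothesis K_gt2 : 2 < #|K|.
Hypothesis uniform_v : uniform_edges v.
Hypothesis linear_v : linear_edges v.

Definition is_edge (g : K -> V) := exists e (p : K -> K), injective p /\ g =1 v e \o p.

Lemma is_edge_inj g : is_edge g -> injective g.
Proof. by move=> [e [p [p_inj gE]]] s t; rewrite !gE => /uniform_v /p_inj. Qed.

Lemma is_edge_ext g g' : g =1 g' -> is_edge g -> is_edge g'.
Proof. by move=> gg' [e [p [pI gE]]]; exists e, p; split=> // s; rewrite -gg'. Qed.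

Lemma is_edge_sub_range g g' s t s' t' : is_edge g -> is_edge g' -> s != t ->
  g s = g' s' -> g t = g' t' -> forall x, exists y, g x = g' y.
Proof.
move=> [e [p [p_inj gE]]] [e' [p' [p'_inj gE']]] neq_st es et x.
have eq_e : e = e'.
  apply: (@linear_v e e' (p s) (p t) (p' s') (p' t')).
  - by rewrite (inj_eq p_inj).
  - by have := es; rewrite gE gE'.
  - by have := et; rewrite gE gE'.
have /codomP[y py] : p x \in codom p' by apply: injF_onto.
by exists y; rewrite gE gE' /= py eq_e.
Qed.

Section Blocks.
Variables (J : Type) (A : K -> J -> bool) (eta : K -> V) (j : V).

Definition block (b : J) (s : K) : V := if A s b then eta s else j.

Lemma block_active b s : A s b -> block b s = eta s.
Proof. by rewrite /block => ->. Qed.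

Lemma block_inactive b s : ~~ A s b -> block b s = j.
Proof. by rewrite /block => /negbTE ->. Qed.

Lemma block_inactive_uniq b s t : injective (block b) -> ~~ A s b -> t != s -> A t b.
Proof.
by move=> inj nAs; apply: contraR => nAt; apply/eqP/inj; rewrite !block_inactive.
Qed.

Lemma is_edge_all_active b : is_edge (block b) -> (forall s, A s b) -> is_edge eta.
Proof. by move=> edge_b Ab; apply: is_edge_ext edge_b => s; apply: block_active. Qed.

(* Two blocks that are edges and miss one index each share [j] and a third vertex, so
   they span the same edge. *)
Lemma eta_eq_at_missing b0 b1 f0 f1 :
  is_edge (block b0) -> is_edge (block b1) -> ~~ A f0 b0 -> ~~ A f1 b1 -> f0 != f1 ->
  eta f1 = eta f0.
Proof.
move=> edge0 edge1 nA0 nA1 neq_f; have [x x0 x1] := exists_third f0 f1 K_gt2.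
have [inj0 inj1] := (is_edge_inj edge0, is_edge_inj edge1).
have act0 s : s != f0 -> A s b0 by apply: block_inactive_uniq.
have act1 s : s != f1 -> A s b1 by apply: block_inactive_uniq.
have neq_f' : f1 != f0 by rewrite eq_sym.
have neq_f0x : f0 != x by rewrite eq_sym.
have eq_j : block b0 f0 = block b1 f1 by rewrite !block_inactive.
have eq_x : block b0 x = block b1 x by rewrite !block_active ?act0 ?act1.
have [y] := is_edge_sub_range edge0 edge1 neq_f0x eq_j eq_x f1.
have [->|y0] := eqVneq y f0; first by rewrite !block_active ?act0 ?act1.
have [->|y1] := eqVneq y f1 => e.
  by case/eqP: neq_f'; apply: inj0; rewrite e !block_inactive.
by case/eqP: (y1); apply: inj0; rewrite e !block_active ?act0 ?act1.
Qed.

Lemma active_union_of_collapse f0 f1 f2 b :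
  (forall s, eta s != j) -> f0 != f1 -> eta f1 = eta f0 -> eta f2 != eta f0 ->
  const_or_inj (block b) -> A f2 b = A f0 b + A f1 b :> nat.
Proof.
move=> etaj neq_f eq_eta neq_eta.
case=> [cst|inj].
  have active_const s t : A s b -> A t b.
    move=> As; apply: contraT => nAt; have := etaj s.
    by rewrite -(block_active As) -(block_inactive nAt) (cst s t) eqxx.
  have same s : A s b = A f0 b by apply/idP/idP; apply: active_const.
  rewrite !same; case A0: (A f0 b) => //.
  by move: neq_eta; rewrite -(block_active A0) -(cst f2) block_active ?same ?eqxx.
have neqA : A f0 b != A f1 b.
  by apply: contra_neq neq_f => eqA; apply: inj; rewrite /block eqA eq_eta.
have [_|nA2] := boolP (A f2 b); first by move: neqA; case: (A f0 b); case: (A f1 b).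
have actN s : eta s = eta f0 -> A s b.
  move=> es; apply: block_inactive_uniq inj nA2 _.
  by apply: contra_neq neq_eta => <-.
by rewrite !actN in neqA.
Qed.

Lemma is_edge_of_blocks b0 :
  (forall s, exists b, A s b) ->
  (forall f0 f1 f2, ~ (forall b, A f2 b = A f0 b + A f1 b :> nat)) ->
  (forall b, is_const (block b) \/ is_edge (block b)) ->
  is_edge (block b0) -> is_edge eta.
Proof.
move=> cover union_free const_or_edge edge0; have inj0 := is_edge_inj edge0.
have [/forallP act|] := boolP [forall s, A s b0]; first exact: is_edge_all_active act.
rewrite negb_forall => /existsP[f0 nA0].
have block0 s : s != f0 -> block b0 s = eta s.
  by move=> sf; apply: block_active; apply: block_inactive_uniq inj0 nA0 sf.
have [eta_f0|eta_f0] := eqVneq (eta f0) j.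
  apply: is_edge_ext edge0 => s; have [->|/block0//] := eqVneq s f0.
  by rewrite block_inactive.
have etaj s : eta s != j.
  have [->//|sf] := eqVneq s f0.
  by rewrite -block0 // -(block_inactive nA0); apply: contra_neq sf; apply: inj0.
have [b1 A1] := cover f0; have [cst|edge1] := const_or_edge b1.
  have eta_const s : eta s = eta f0.
    have [As|nAs] := boolP (A s b1).
      by rewrite -(block_active As) (cst s f0) block_active.
    by move: eta_f0; rewrite -(block_active A1) -(cst s) block_inactive ?eqxx.
  have [f1 f10 _] := exists_third f0 f0 K_gt2.
  have [f2 f20 f21] := exists_third f0 f1 K_gt2.
  by rewrite (inj0 f2 f1) ?eqxx // in f21; rewrite !block0 // !eta_const.
have [/forallP act|] := boolP [forall s, A s b1]; first exact: is_edge_all_active act.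
rewrite negb_forall => /existsP[f1 nA1].
have f10 : f1 != f0 by apply: contraNneq nA1 => ->.
have eta_f1 : eta f1 = eta f0.
  by apply: eta_eq_at_missing edge0 edge1 nA0 nA1 _; rewrite eq_sym.
have [f2 f20 f21] := exists_third f0 f1 K_gt2.
case: (union_free f0 f1 f2) => b; apply: active_union_of_collapse => //.
- by rewrite eq_sym.
- by rewrite -eta_f1 -!block0 //; apply: contra_neq f21; apply: inj0.
- by have [cst|/is_edge_inj inj] := const_or_edge b; [left|right].
Qed.

End Blocks.

End Edges.

(* The points [X], embedded by [vec] in the cube over [K], are projected to the
   hypergraph by [h]; [js] lists the vertices of the hypergraph along which the
   amalgamation has already been carried out. *)
Record picture (K : finType) (V : eqType) (E : Type) (v : E -> K -> V) (C I X : finType)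
    (vec : X -> {ffun I -> K}) (h : X -> V) (js : seq V) : Prop := Picture {
  picture_projection : forall x y, vec x = vec y -> h x = h y;
  picture_quasiline : forall x : K -> X, quasiline (vec \o x) -> is_edge v (h \o x);
  picture_ramsey : forall c : {ffun I -> K} -> C, exists gam : V -> C, forall e,
    exists (l : K -> X) (t : template I K),
    [/\ exists i, active t i,
        vec \o l =1 line_point t,
        h \o l =1 v e &
        forall s, v e s \in js -> c (vec (l s)) = gam (v e s)] }.

Section PictureStart.
Variables (K : finType) (V : eqType) (C E : finType) (v : E -> K -> V) (o0 o1 : K).
Hypothesis K_gt2 : 2 < #|K|.
Hypothesis neq_o : o0 != o1.

(* The coordinates [(e, true)] take only two values, which confines a quasiline to the
   points of a single edge. *)
Definition edge_line_vec (x : E * K) : {ffun E * bool -> K} :=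
  [ffun i => if i.1 == x.1 then if i.2 then o1 else x.2 else o0].

Lemma edge_line_vec_true e x : edge_line_vec x (e, true) = if e == x.1 then o1 else o0.
Proof. by rewrite ffunE. Qed.

Lemma edge_line_vec_false e x : edge_line_vec x (e, false) = if e == x.1 then x.2 else o0.
Proof. by rewrite ffunE. Qed.

Lemma edge_line_vec_inj : injective edge_line_vec.
Proof.
move=> [e s] [e' s'] eq_vec; have := edge_line_vec_true e (e, s).
rewrite eq_vec edge_line_vec_true /= eqxx; have [eq_e _|_ eq_o] := eqVneq e e'.
  have := edge_line_vec_false e (e, s).
  by rewrite eq_vec !edge_line_vec_false /= -eq_e eqxx => ->.
by have := neq_o; rewrite eq_o eqxx.
Qed.

Lemma edge_line_vec_quasiline (x : K -> E * K) :
  quasiline (edge_line_vec \o x) -> is_edge v (fun s => v (x s).1 (x s).2).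
Proof.
move=> [ci [i inj_i]]; exists (x o0).1, (fun s => (x s).2).
have eq_fst s : (x s).1 = (x o0).1.
  have [cst|inj] := ci ((x o0).1, true).
    have := cst s o0; rewrite /= !edge_line_vec_true eqxx.
    have [->//|_ eq_o] := eqVneq (x o0).1 (x s).1.
    by have := neq_o; rewrite eq_o eqxx.
  have : #|K| <= #|[set o0; o1]|.
    rewrite -cardsT -(card_imset _ inj); apply/subset_leq_card/subsetP.
    move=> _ /imsetP[t _ ->]; rewrite edge_line_vec_true !inE.
    by case: ifP; rewrite eqxx ?orbT.
  by rewrite leqNgt cards2 neq_o K_gt2.
split=> [|s /=]; last by rewrite eq_fst.
have [cst|inj] := ci ((x o0).1, false); last first.
  by move=> s t eq_snd; apply: inj; rewrite /= !edge_line_vec_false !eq_fst eq_snd.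
have eq_snd : (x o0).2 = (x o1).2.
  by have := cst o0 o1; rewrite /= !edge_line_vec_false (eq_fst o1) eqxx.
move/eqP: neq_o; case; apply: inj_i => /=.
by rewrite (surjective_pairing (x o1)) (eq_fst o1) -eq_snd -surjective_pairing.
Qed.

Lemma edge_line_picture :
  picture v C edge_line_vec (fun x => v x.1 x.2) [::].
Proof.
split=> [x y /edge_line_vec_inj -> //|x|c]; first exact: edge_line_vec_quasiline.
exists (fun=> c [ffun=> o0]) => e.
exists (fun s => (e, s)),
  [ffun i => if i.1 == e then if i.2 then Some o1 else None else Some o0].
split=> //; first by exists (e, false); rewrite /active ffunE /= eqxx.
by move=> s; apply/ffunP => -[e' b]; rewrite !ffunE /=; case: eqP; case: b.
Qed.

End PictureStart.

Section Amalgamation.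
Variables (K : finType) (V : eqType) (E : Type) (v : E -> K -> V).
Hypothesis K_gt2 : 2 < #|K|.
Hypothesis uniform_v : uniform_edges v.
Hypothesis linear_v : linear_edges v.
Variables (C I X J : finType) (vec : X -> {ffun I -> K}) (h : X -> V) (js : seq V) (j : V).
Variable Lines : {set template J X}.
Hypothesis pic : picture v C vec h js.
Hypothesis lines : union_free_HJ_lines C [seq x <- enum X | h x == j] Lines.

Definition flatten_word (w : J -> X) : {ffun J * I -> K} := [ffun bi => vec (w bi.1) bi.2].

Local Notation points := ({t | t \in Lines} * X)%type.

Definition amalgam_vec (z : points) := flatten_word (line_point (val z.1) z.2).

Definition amalgam_label (z : points) := h z.2.

Lemma amalgam_vecE z b i : amalgam_vec z (b, i) = vec (line_point (val z.1) z.2 b) i.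
Proof. by rewrite ffunE. Qed.

Lemma label_line_point t x b : t \in Lines ->
  h (line_point t x b) = if active t b then h x else j.
Proof.
move=> tL; rewrite /active ffunE; case e: (t b) => [y|] //=.
by have := HJ_letters lines tL e; rewrite mem_filter => /andP[/eqP].
Qed.

Lemma block_label (z : K -> points) b s :
  h (line_point (val (z s).1) (z s).2 b) =
  block (fun s b => active (val (z s).1) b) (amalgam_label \o z) j b s.
Proof. exact/label_line_point/(valP (z s).1). Qed.

Lemma amalgam_projection z z' :
  amalgam_vec z = amalgam_vec z' -> amalgam_label z = amalgam_label z'.
Proof.
move=> eq_vec.
have eq_label b : h (line_point (val z.1) z.2 b) = h (line_point (val z'.1) z'.2 b).
  by apply: (picture_projection pic); apply/ffunP => i; rewrite -!amalgam_vecE eq_vec.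
have [b0 a0] := HJ_active lines (valP z.1); have [b1 a1] := HJ_active lines (valP z'.1).
have := eq_label b0; have := eq_label b1.
rewrite !label_line_point ?(valP z.1) ?(valP z'.1) // a0 a1 /amalgam_label.
by case: ifP => // _ ->; case: ifP.
Qed.

Lemma amalgam_quasiline (z : K -> points) :
  quasiline (amalgam_vec \o z) -> is_edge v (amalgam_label \o z).
Proof.
move=> [ci [[b0 i0] inj0]].
pose column b s := line_point (val (z s).1) (z s).2 b.
have ci_column b i : const_or_inj (fun s => vec (column b s) i).
  have := ci (b, i); congr const_or_inj.
  by apply/funext => s; rewrite /= amalgam_vecE.
have edge_column b : quasiline (vec \o column b) ->
    is_edge v (block (fun s b => active (val (z s).1) b) (amalgam_label \o z) j b).
  move=> /(picture_quasiline pic); apply: is_edge_ext => s; exact: block_label.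
apply: (is_edge_of_blocks K_gt2 uniform_v linear_v
  (A := fun s b => active (val (z s).1) b) (j := j) (b0 := b0)).
- by move=> s; apply: (HJ_active lines); apply: valP.
- move=> f0 f1 f2 U.
  have uf := HJ_union_free lines (valP (z f0).1) (valP (z f1).1) (valP (z f2).1).
  exact: uf (fun b _ => U b).
- move=> b; have [/edge_column|cst] := quasiline_or_const (ci_column b); first by right.
  by left=> s t; rewrite -!block_label; apply: (picture_projection pic); apply: cst.
- apply: edge_column; split; first exact: ci_column.
  by exists i0 => s t e; apply: inj0; rewrite /= !amalgam_vecE.
Qed.

Definition lift_word (t : template J X) (w : {ffun I -> K}) : {ffun J * I -> K} :=
  [ffun bi => if t bi.1 is Some y then vec y bi.2 else w bi.2].

Definition lift_template (t : template J X) (t0 : template I K) : template (J * I)%type K :=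
  [ffun bi => if t bi.1 is Some y then Some (vec y bi.2) else t0 bi.2].

Lemma flatten_line_point t x : flatten_word (line_point t x) = lift_word t (vec x).
Proof. by apply/ffunP => -[b i]; rewrite !ffunE /=; case: (t b). Qed.

Lemma lift_line_point t t0 s :
  lift_word t (line_point t0 s) = line_point (lift_template t t0) s.
Proof. by apply/ffunP => -[b i]; rewrite !ffunE /=; case: (t b). Qed.

Lemma amalgam_ramsey (c : {ffun J * I -> K} -> C) : exists gam : V -> C, forall e,
  exists (l : K -> points) (t : template (J * I)%type K),
  [/\ exists i, active t i,
      amalgam_vec \o l =1 line_point t,
      amalgam_label \o l =1 v e &
      forall s, v e s \in j :: js -> c (amalgam_vec (l s)) = gam (v e s)].
Proof.
have [t tL mono_t] := HJ_monochromatic lines (fun w => c (flatten_word w)).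
have [gam gamP] := picture_ramsey pic (c \o lift_word t).
have [col colP] : exists col, forall x, h x = j -> c (lift_word t (vec x)) = col.
  have in_fibre x : h x = j -> x \in [seq x <- enum X | h x == j].
    by move=> hx; rewrite mem_filter hx eqxx mem_enum.
  case: (pickP (fun x => h x == j)) => [x0 /eqP hx0|empty]; last first.
    by exists (gam j) => x hx; have := empty x; rewrite hx eqxx.
  exists (c (lift_word t (vec x0))) => x hx.
  by rewrite -!flatten_line_point; apply: mono_t; apply: in_fibre.
exists (fun a => if a == j then col else gam a) => e.
have [l [t0 [[i act_i] l_line l_edge l_color]]] := gamP e.
exists (fun s => (Sub t tL, l s)), (lift_template t t0).
have vecE s : amalgam_vec (Sub t tL, l s) = lift_word t (vec (l s)).
  by rewrite /amalgam_vec SubK flatten_line_point.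
split=> [|s||s]; last 1 first.
- rewrite vecE inE; case: eqVneq => [ej _|_ /= v_js]; last exact: l_color.
  by apply: colP; rewrite -ej; apply: l_edge.
- have [b act_b] := HJ_active lines tL; exists (b, i).
  by move: act_b act_i; rewrite /active ffunE /=; case: (t b).
- by rewrite /= vecE -lift_line_point; have /= -> := l_line s.
- exact: l_edge.
Qed.

Lemma amalgam_picture : picture v C amalgam_vec amalgam_label (j :: js).
Proof.
by split; [exact: amalgam_projection|exact: amalgam_quasiline|exact: amalgam_ramsey].
Qed.

End Amalgamation.

Lemma picture_exists (K V C E : finType) (v : E -> K -> V) : 2 < #|K| ->
  uniform_edges v -> linear_edges v -> forall js : seq V,
  exists (I X : finType) (vec : X -> {ffun I -> K}) (h : X -> V), picture v C vec h js.
Proof.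
move=> K_gt2 uniform_v linear_v; elim=> [|j js [I [X [vec [h pic]]]]].
  have /card_gt1P[o0 [o1 [_ _ neq_o]]] : 1 < #|K| by apply: ltnW.
  by do 4!eexists; apply: edge_line_picture K_gt2 neq_o.
have [J [Lines lines]] := union_free_hales_jewett [seq x <- enum X | h x == j] C.
by do 4!eexists; exact (amalgam_picture K_gt2 uniform_v linear_v pic lines).
Qed.

Definition image_selection (Om T : finType) (U : eqType) (g : T -> U)
    (sel : Om -> T -> bool) (pT : predType T) (D : pT) (om : Om) (y : U) :=
  [exists x in D, (g x == y) && sel om x].

Lemma image_selectionP (Om T : finType) (U : eqType) (g : T -> U)
    (sel : Om -> T -> bool) (pT : predType T) (D : pT) om y :
  reflect (exists x, [/\ x \in D, g x = y & sel om x]) (image_selection g sel D om y).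
Proof.
apply: (iffP exists_inP) => [[x xD /andP[/eqP gx sx]]|[x [xD gx sx]]]; exists x => //.
by rewrite gx eqxx.
Qed.

Lemma dense_image_selection (R : realType) (mu : R) (Om T : finType) (U : eqType)
    (g : T -> U) (sel : Om -> T -> bool) (pT : predType T) (D : pT) :
  dense_selection mu sel D -> dense_selection mu (image_selection g sel D) (image g D).
Proof.
move=> [Om_gt0 dense]; split=> // _ /imageP[x xD ->].
apply: le_trans (dense x xD) _; rewrite ler_nat; apply/subset_leq_card/subsetP => om.
by rewrite !inE => sx; apply/image_selectionP; exists x.
Qed.

Lemma sparse_word_system (R : realType) (K C : finType) (mu : R) : 2 < #|K| ->
  (mu < (#|K|%:R - 1) / #|K|%:R)%R ->
  exists (I Om : finType) (W : seq {ffun I -> K}) (sel : Om -> {ffun I -> K} -> bool),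
  [/\ forall c : {ffun I -> K} -> C, exists t : template I K,
        [/\ exists i, active t i, forall s, line_point t s \in W &
            is_const (c \o line_point t)],
      forall om (y : K -> {ffun I -> K}), (forall s, sel om (y s)) -> ~ quasiline y &
      dense_selection mu sel W].
Proof.
move=> K_gt2 mu_lt.
have [V [E [Om [v [sel [uniform_v linear_v ramsey_v indep_v dense_v]]]]]] :=
  sparse_hypergraph C (ltnW K_gt2) mu_lt.
have [I [X [vec [h pic]]]] := picture_exists C K_gt2 uniform_v linear_v (enum V).
exists I, Om, (image vec X), (image_selection vec (fun om x => sel om (h x)) X); split.
- move=> c; have [gam gamP] := picture_ramsey pic c; have [e const_e] := ramsey_v gam.
  have [l [t [act_t l_line _ l_color]]] := gamP e; exists t; split=> // s.
    by rewrite -l_line; apply: image_f.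
  by move=> s'; rewrite /= -!l_line /= !l_color ?mem_enum //; apply: const_e.
- move=> om y sel_y ql.
  have /choice[x xP] : forall s, exists x, vec x = y s /\ sel om (h x).
    by move=> s; have /image_selectionP[x [_ ? ?]] := sel_y s; exists x.
  have eq_y : vec \o x = y by apply/funext => s; apply: (xP s).1.
  have [|e [p [p_inj hx]]] := picture_quasiline pic (x := x); first by rewrite eq_y.
  apply: (indep_v om e) => s; have /codomP[s' ->] : s \in codom p by apply: injF_onto.
  by have := hx s' => /= <-; apply: (xP s').2.
- apply: dense_image_selection; case: dense_v => Om_gt0 dense_v.
  by split=> // x _; apply: dense_v.
Qed.

(** * From words to lattice points *)

Local Open Scope ring_scope.

Section SquaredDistance.
Variable d : nat.
Implicit Types (x y a : lpt d) (q : int).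

Definition sqdistz x y : int := \sum_(i < d) (x 0 i - y 0 i) ^+ 2.

Lemma sqdistz_ge0 x y : 0 <= sqdistz x y.
Proof. by apply: sumr_ge0 => i _; apply: sqr_ge0. Qed.

Lemma sqdistz_eq0 x y : (sqdistz x y == 0) = (x == y).
Proof.
rewrite psumr_eq0 => [|i _]; last exact: sqr_ge0.
apply/allP/eqP => [diff0|-> i _]; last by rewrite subrr expr0n.
apply/rowP => i; have := diff0 i; rewrite mem_index_enum sqrf_eq0 subr_eq0 => /(_ isT).
by move/eqP.
Qed.

Lemma sqdistzz x : sqdistz x x = 0.
Proof. by apply/eqP; rewrite sqdistz_eq0. Qed.

Lemma sqdistz_ge1 x y : x != y -> 1 <= sqdistz x y.
Proof. by move=> neq; rewrite -gtz0_ge1 lt0r sqdistz_eq0 neq sqdistz_ge0. Qed.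

Lemma sqdistzDr x y a : sqdistz (x + a) (y + a) = sqdistz x y.
Proof. by apply: eq_bigr => i _; rewrite !mxE; congr (_ ^+ 2); ring. Qed.

Lemma sqdistz_scale_add q x y x' y' :
  sqdistz (q *: x + x') (q *: y + y') = sqdistz x y * q ^+ 2 +
    (2 * \sum_(i < d) (x 0 i - y 0 i) * (x' 0 i - y' 0 i)) * q + sqdistz x' y'.
Proof.
rewrite /sqdistz mulr_suml mulr_sumr mulr_suml -!big_split /=; apply: eq_bigr => i _.
by rewrite !mxE; ring.
Qed.

Lemma sqdistz_coord x y i : (x 0 i - y 0 i) ^+ 2 <= sqdistz x y.
Proof.
rewrite /sqdistz (bigD1 i) //= lerDl; apply: sumr_ge0 => j _; exact: sqr_ge0.
Qed.

Lemma sqdistz_ub x y (B : int) :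
  (forall i, - B <= x 0 i - y 0 i <= B) -> sqdistz x y <= d%:Z * B ^+ 2.
Proof.
move=> diff_ub; apply: le_trans (_ : \sum_(i < d) B ^+ 2 <= _).
  by apply: ler_sum => i _; have := diff_ub i; nia.
by rewrite sumr_const card_ord -[d%:Z]natz mulr_natl.
Qed.

Lemma sqdist_embed (R : realType) x y : sqdist (embed R x) (embed R y) = (sqdistz x y)%:~R.
Proof.
rewrite /sqdist /sqdistz rmorph_sum; apply: eq_bigr => i _.
by rewrite !mxE rmorphXn rmorphB.
Qed.

End SquaredDistance.

Lemma quadratic_int_eq0 (a b c : int) (q : nat) : (`|a| + `|b| + `|c| < q)%N ->
  a * q%:Z ^+ 2 + b * q%:Z + c = 0 -> a = 0 /\ c = 0.
Proof.
move=> lt_q e.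
have digits_eq0 (x y : int) : (`|x| < q)%N -> x + y * q%:Z = 0 -> x = 0 /\ y = 0.
  move=> lt_xq e'; have y0 : y = 0 by nia.
  by rewrite y0 in e'; split; lia.
have [||-> e'] := digits_eq0 c (a * q%:Z + b); [lia|lia|].
by have [||_ ->] := digits_eq0 b a; [lia|lia|].
Qed.

Lemma quadratic_int_family_eq0 (P : finType) (a b c : P -> int) :
  exists2 q : nat, (0 < q)%N &
    forall p, a p * q%:Z ^+ 2 + b p * q%:Z + c p = 0 -> a p = 0 /\ c p = 0.
Proof.
exists (\sum_(p : P) (`|a p| + `|b p| + `|c p|)).+1%N => // p.
by apply: quadratic_int_eq0; rewrite ltnS (bigD1 p) //= leq_addr.
Qed.

Section Similarity.
Variables (K : finType) (d : nat) (f : K -> lpt d).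
Hypothesis f_inj : injective f.

(* Homogeneous form of "similar to [f]": constant families are included, which makes
   the condition pass to single coordinates. *)
Definition similar (z : K -> lpt d) := forall s t s' t',
  sqdistz (z s) (z t) * sqdistz (f s') (f t') = sqdistz (z s') (z t') * sqdistz (f s) (f t).

Lemma similar_const_or_inj z : similar z -> const_or_inj z.
Proof.
move=> sim; have [zI|] := pselect (injective z); first by right.
move=> /existsNP[s /existsNP[t /not_implyP[est neq_st]]]; left=> s' t'; apply/eqP.
have /eqP := sim s t s' t'; rewrite est sqdistzz mul0r eq_sym mulf_eq0 !sqdistz_eq0.
by case/orP => // /eqP /f_inj.
Qed.

Lemma similar_ext z z' : z =1 z' -> similar z -> similar z'.
Proof. by move=> eq_z sim s t s' t'; rewrite -!eq_z. Qed.

Lemma similar_add z a : similar z -> similar (fun s => z s + a).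
Proof. by move=> sim s t s' t'; rewrite !sqdistzDr. Qed.

Lemma separating_scale (P : finType) (x y : P -> K -> lpt d) :
  exists2 q : nat, (0 < q)%N & forall p,
    similar (fun s => q%:Z *: x p s + y p s) -> similar (x p) /\ similar (y p).
Proof.
pose dot p s t := 2 * \sum_(i < d) (x p s 0 i - x p t 0 i) * (y p s 0 i - y p t 0 i).
pose defect (g : K -> K -> int) s t s' t' :=
  g s t * sqdistz (f s') (f t') - g s' t' * sqdistz (f s) (f t).
pose coef (g : P -> K -> K -> int) (j : P * (K * K) * (K * K)) :=
  defect (g j.1.1) j.1.2.1 j.1.2.2 j.2.1 j.2.2.
pose sqx p s t := sqdistz (x p s) (x p t); pose sqy p s t := sqdistz (y p s) (y p t).
have [q q_gt0 qP] := quadratic_int_family_eq0 (coef sqx) (coef dot) (coef sqy).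
exists q => // p sim.
have defect_eq0 s t s' t' : defect (sqx p) s t s' t' = 0 /\ defect (sqy p) s t s' t' = 0.
  apply: (qP (p, (s, t), (s', t'))); have /eqP := sim s t s' t'.
  rewrite -subr_eq0 !sqdistz_scale_add -/(dot p s t) -/(dot p s' t') => /eqP <-.
  by rewrite /coef /defect /=; ring.
by split=> s t s' t'; have [x_eq0 y_eq0] := defect_eq0 s t s' t';
  apply/eqP; rewrite -subr_eq0; apply/eqP.
Qed.

Definition weighted_sum (I : Type) (q : I -> nat) (l : seq I) (w : I -> K) : lpt d :=
  \sum_(i <- l) (q i)%:Z *: f (w i).

Lemma separating_weights_seq (I : finType) (l : seq I) : uniq l ->
  exists2 q : I -> nat, forall i, (0 < q i)%N &
  forall y : K -> {ffun I -> K}, similar (fun s => weighted_sum q l (y s)) ->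
    forall i, i \in l -> similar (fun s => f (y s i)).
Proof.
elim: l => [_|a l IH /andP[al /IH[q q_gt0 qP]]]; first by exists (fun=> 1%N).
have [Q Q_gt0 QP] := @separating_scale {ffun K -> {ffun I -> K}}
  (fun y s => f (y s a)) (fun y s => weighted_sum q l (y s)).
pose q' i := if i == a then Q else q i.
exists q' => [i|y sim]; first by rewrite /q'; case: ifP.
have weighted_sum_cons s :
    weighted_sum q' (a :: l) (y s) = Q%:Z *: f (y s a) + weighted_sum q l (y s).
  rewrite /weighted_sum big_cons /q' eqxx; congr (_ + _); apply: eq_big_seq => i il.
  by case: eqP => // ia; rewrite ia (negbTE al) in il.
have [|sim_a sim_l] := QP (finfun y).
  by apply: similar_ext sim => s; rewrite ffunE.
move=> i; rewrite inE => /predU1P[->|il].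
  by apply: similar_ext sim_a => s; rewrite ffunE.
by apply: qP il; apply: similar_ext sim_l => s; rewrite ffunE.
Qed.

Definition word_point (I : finType) (q : I -> nat) (w : {ffun I -> K}) : lpt d :=
  weighted_sum q (index_enum I) w.

Lemma separating_weights (I : finType) :
  exists2 q : I -> nat, forall i, (0 < q i)%N &
  forall y : K -> {ffun I -> K}, similar (word_point q \o y) ->
    forall i, const_or_inj (fun s => y s i).
Proof.
have [q q_gt0 qP] := separating_weights_seq (index_enum_uniq I); exists q => // y sim i.
have [cst|inj] := similar_const_or_inj (qP y sim i (mem_index_enum i)).
  by left=> s t; apply/f_inj/cst.
by right=> s t e; apply: inj; rewrite e.
Qed.

Lemma word_point_line (I : finType) (q : I -> nat) (t : template I K) :
  (forall i, (0 < q i)%N) -> (exists i, active t i) ->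
  exists (x : lpt d) (lam : nat), (0 < lam)%N /\
    forall s, word_point q (line_point t s) = x + lam%:Z *: f s.
Proof.
move=> q_gt0 [i0 act_i0].
exists (\sum_(i | ~~ active t i) (q i)%:Z *: odflt 0 (omap f (t i))).
exists (\sum_(i | active t i) q i)%N; split=> [|s].
  by rewrite (bigD1 i0) //= ltn_addr.
rewrite /word_point /weighted_sum (bigID (active t)) /= addrC; congr (_ + _).
  by apply: eq_bigr => i; rewrite /active ffunE; case: (t i).
rewrite -natz natr_sum scaler_suml; apply: eq_bigr => i; rewrite natz /active ffunE.
by case: (t i).
Qed.

Definition similar_free (Z : seq (lpt d)) :=
  forall z : K -> lpt d, (forall s, z s \in Z) -> similar z -> is_const z.

Definition densely_similar_free (R : realType) (mu : R) (X : lpt d -> Prop) :=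
  forall Y : seq (lpt d), uniq Y -> (forall y, y \in Y -> X y) -> exists Z,
    [/\ uniq Z, {subset Z <= Y}, similar_free Z & mu * (size Y)%:R <= (size Z)%:R].

Lemma dense_selection_average (R : realType) (mu : R) (T : eqType) (Om : finType)
    (sel : Om -> T -> bool) (Y : seq T) :
  dense_selection mu sel Y ->
  exists om, mu * (size Y)%:R <= (size [seq y <- Y | sel om y])%:R.
Proof.
move=> [Om_gt0 dense]; apply: contrapT => /forallNP few.
have double_count : (\sum_om size [seq y <- Y | sel om y] =
    \sum_(y <- Y) #|[set om | sel om y]|)%N.
  under eq_bigr do rewrite size_filter -sum1_count big_mkcond.
  by rewrite exchange_big; apply: eq_bigr => y _; rewrite -sum1dep_card [RHS]big_mkcond.
have sum_ge : mu * (size Y)%:R * #|Om|%:R <= (\sum_(y <- Y) #|[set om | sel om y]|)%N%:R.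
  rewrite natr_sum mulrAC -sum1_size natr_sum mulr_sumr [leLHS]big_seq [leRHS]big_seq.
  by apply: ler_sum => y yY; rewrite mulr1; apply: dense.
have sum_lt : (\sum_om size [seq y <- Y | sel om y])%N%:R < mu * (size Y)%:R * #|Om|%:R.
  rewrite natr_sum mulr_natr -sumr_const; have [om0 _] := card_gt0P Om_gt0.
  apply: ltr_sum => [|om _]; first by apply/hasP; exists om0; rewrite ?mem_index_enum.
  by rewrite ltNge; apply/negP.
by have := le_lt_trans sum_ge; rewrite -double_count => /(_ _ sum_lt); rewrite ltxx.
Qed.

Lemma sparse_lattice_block (R : realType) (mu : R) (r : nat) : (2 < #|K|)%N ->
  mu < (#|K|%:R - 1) / #|K|%:R ->
  exists S : seq (lpt d),
    (forall c : lpt d -> 'I_r, mono_homothetic_copy (codom f) (fun x => x \in S) c) /\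
    densely_similar_free mu (fun x => x \in S).
Proof.
move=> K_gt2 mu_lt.
have [I [Om [W [sel [ramsey_W indep_W dense_W]]]]] := sparse_word_system 'I_r K_gt2 mu_lt.
have [q q_gt0 qP] := separating_weights I.
have [Om_gt0 dense] := dense_image_selection (word_point q) dense_W.
exists (image (word_point q) W); split=> [c|Y uY YS].
  have [t [act_t t_W mono_t]] := ramsey_W (c \o word_point q).
  have [x [lam [lam_gt0 pointE]]] := word_point_line q_gt0 act_t.
  have /card_gt0P[s0 _] : (0 < #|K|)%N by apply: ltn_trans K_gt2.
  exists x, lam, (c (word_point q (line_point t s0))); split=> // _ /codomP[s ->].
  by rewrite -pointE; split; [apply: image_f|apply: mono_t].
pose sel_points := image_selection (word_point q) sel W.
have [|om le_om] := @dense_selection_average _ mu _ _ sel_points Y.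
  by split=> // y /YS; apply: dense.
exists [seq y <- Y | sel_points om y]; split=> //.
- exact: filter_uniq.
- exact: mem_subseq (filter_subseq _ _).
move=> z z_sel sim.
have /choice[y yP] : forall s, exists y, word_point q y = z s /\ sel om y.
  move=> s; have := z_sel s; rewrite mem_filter => /andP[/image_selectionP[y [_ ? ?]] _].
  by exists y.
have ci i : const_or_inj (fun s => y s i).
  by apply: qP i; apply: similar_ext sim => s; rewrite /= (yP s).1.
have [ql|cst] := quasiline_or_const ci; last first.
  by move=> s t; rewrite -(yP s).1 -(yP t).1 (cst s t).
by case: (indep_W om y _ ql) => s; apply: (yP s).2.
Qed.

End Similarity.

(** * Spreading out the blocks *)

Lemma mono_homothetic_copy_translate (d r : nat) (F : seq (lpt d)) (X : lpt d -> Prop)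
    (c : lpt d -> 'I_r) (a : lpt d) :
  mono_homothetic_copy F X (fun x => c (x + a)) ->
  mono_homothetic_copy F (fun x => X (x - a)) c.
Proof.
move=> [x [lam [col [lam_gt0 copy]]]]; exists (x + a), lam, col; split=> // f /copy.
by rewrite (addrAC x a) addrK.
Qed.

Lemma bounded_coordinates (d : nat) (S : seq (lpt d)) :
  exists b : nat, forall x i, x \in S -> (`|x 0%R i| <= b)%N.
Proof.
exists (\max_(x <- S) \max_(i < d) `|x 0%R i|)%N => x i xS.
by rewrite (big_rem x xS) (bigD1 i) //= !leq_max leqnn.
Qed.

Lemma fast_growing_sequence (A : nat) (b : nat -> nat) :
  exists P : nat -> nat, (forall r, b r < P r)%N /\
    forall t r, (t < r)%N -> (A * P t + b t < P r)%N.
Proof.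
pose B r := (\sum_(i < r.+1) b i).+1%N.
have lt_bB r : (b r < B r)%N by rewrite ltnS big_ord_recr leq_addl.
have leB : {homo B : t r / (t <= r)%N}.
  apply: homo_leq => [//|m n p|r]; first exact: leq_trans.
  by rewrite ltnS [leqRHS]big_ord_recr leq_addr.
exists (fun r => A.+1 ^ r * B r)%N; split=> [r|t r lt_tr].
  by apply: leq_trans (lt_bB r) _; rewrite leq_pmull ?expn_gt0.
apply: (@leq_trans (A.+1 ^ t.+1 * B t)).
  rewrite expnS -mulnA mulSnr ltn_add2l.
  by apply: leq_trans (lt_bB t) _; rewrite leq_pmull ?expn_gt0.
by rewrite leq_mul ?leB ?leq_pexp2l // ltnW.
Qed.

Section Spreading.
Variables (K : finType) (d : nat) (f : K -> lpt d).
Hypotheses (K_gt2 : (2 < #|K|)%N) (d_gt0 : (0 < d)%N) (f_inj : injective f).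

Lemma sqdistz_bounded : exists C : nat, forall s t, sqdistz (f s) (f t) <= C%:Z.
Proof.
exists (\max_(p : K * K) `|sqdistz (f p.1) (f p.2)|)%N => s t.
rewrite -[leLHS]gez0_abs ?sqdistz_ge0 // lez_nat.
by rewrite (bigD1 (s, t)) //= leq_maxl.
Qed.

Lemma similar_distortion (C : int) z s t s' t' :
  (forall s t, sqdistz (f s) (f t) <= C) -> similar f z -> s' != t' ->
  sqdistz (z s) (z t) <= sqdistz (z s') (z t') * C.
Proof.
move=> f_ub sim neq; have := f_ub s t; have := sim s t s' t'.
have : 1 <= sqdistz (f s') (f t') by rewrite sqdistz_ge1 ?(inj_eq f_inj).
move: (sqdistz_ge0 (z s) (z t)) (sqdistz_ge0 (z s') (z t')); nia.
Qed.

(* By pigeonhole two points lie in the same cluster; as a similar copy has bounded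
   distortion, the others cannot be much farther apart. *)
Lemma similar_in_cluster (C A P : nat) (far : K -> bool) (z : K -> lpt d) :
  (0 < P)%N -> (forall s t, sqdistz (f s) (f t) <= C%:Z) -> (4 * d * C + 4 <= A)%N ->
  similar f z ->
  (forall s i, if far s then (A * P)%:Z - P%:Z <= z s 0 i <= (A * P)%:Z + P%:Z
               else 0 <= z s 0 i <= P%:Z) ->
  is_const far.
Proof.
move=> P_gt0 f_ub le_A sim z_box.
have /injectivePn[x [y neq_xy eq_far]] : ~~ injectiveb far.
  by apply/negP => /injectiveP /leq_card; rewrite card_bool leqNgt K_gt2.
have near_xy : sqdistz (z x) (z y) <= d%:Z * (2 * P%:Z) ^+ 2.
  apply: sqdistz_ub => i; have := z_box x i; have := z_box y i; rewrite eq_far.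
  by case: (far y); lia.
suff separated s t : far s -> ~~ far t -> False.
  move=> s t; have [fs|nfs] := boolP (far s); have [ft|nft] := boolP (far t) => //.
    by case: (separated s t).
  by case: (separated t s).
move=> fs nft; pose i0 := Ordinal d_gt0.
have apart : ((A%:Z - 2) * P%:Z) ^+ 2 <= sqdistz (z s) (z t).
  apply: le_trans (sqdistz_coord _ _ i0).
  have := z_box s i0; have := z_box t i0; rewrite fs (negbTE nft).
  move: (z s _ _) (z t _ _) => a b a_box b_box.
  have le_ab : (A%:Z - 2) * P%:Z <= a - b by lia.
  by apply: lerXn2r; rewrite ?nnegrE //; nia.
have : ((A%:Z - 2) * P%:Z) ^+ 2 <= d%:Z * (2 * P%:Z) ^+ 2 * C%:Z.
  apply: le_trans apart (le_trans (similar_distortion s t f_ub sim neq_xy) _).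
  exact: ler_wpM2r.
have -> : d%:Z * (2 * P%:Z) ^+ 2 * C%:Z = (4 * d * C)%N%:Z * P%:Z ^+ 2.
  by rewrite !PoszM; ring.
rewrite exprMn ler_pM2r ?exprn_gt0 //; move: (4 * d * C)%N le_A => n.
by nia.
Qed.

Lemma similar_copies_localized (S : nat -> seq (lpt d)) :
  exists base : nat -> lpt d,
    (forall r x i, x - base r \in S r -> 0 <= x 0 i) /\
    (forall (z : K -> lpt d) (rho : K -> nat),
       (forall s, z s - base (rho s) \in S (rho s)) -> similar f z -> is_const rho).
Proof.
have /choice[b b_ub] := fun r => bounded_coordinates (S r).
have [C f_ub] := sqdistz_bounded; pose A := (4 * d * C + 4)%N.
have [P [lt_bP growP]] := fast_growing_sequence A b.
have leP_AP r : (P r <= A * P r)%N by rewrite leq_pmull // /A addn4.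
exists (fun r => const_mx (A * P r)%N%:Z).
have coord r (x : lpt d) i : x - const_mx (A * P r)%N%:Z \in S r ->
    (A * P r)%N%:Z - (b r)%:Z <= x 0 i <= (A * P r)%N%:Z + (b r)%:Z.
  move=> /(b_ub _ _ i); rewrite !mxE.
  by move: (x 0 i) (A * P r)%N (b r) => a c e; lia.
split=> [r x i /(coord _ _ i)|z rho z_in sim].
  have := leP_AP r; have := lt_bP r.
  by move: (x 0 i) (A * P r)%N => a n; lia.
have /card_gt0P[s0 _] : (0 < #|K|)%N by apply: ltn_trans K_gt2.
case: (arg_maxnP rho (erefl : xpredT s0)) => m _ max_m.
pose far s := rho s == rho m.
have far_const : is_const far.
  apply: (similar_in_cluster (P := P (rho m)) _ f_ub (leqnn A) sim).
    by apply: leq_ltn_trans (lt_bP _).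
  move=> s i; have := coord _ _ i (z_in s); have := lt_bP (rho m); have := lt_bP (rho s).
  rewrite /far -/A; case: eqVneq => [->|neq]; first by lia.
  have lt_rho : (rho s < rho m)%N by rewrite ltn_neqAle neq; apply: max_m.
  by have := growP _ _ lt_rho; have := leP_AP (rho s); lia.
have rho_m s : rho s = rho m by apply/eqP; rewrite -/(far s) (far_const s m) /far.
by move=> s t; rewrite !rho_m.
Qed.

Lemma densely_similar_free_translate (R : realType) (mu : R) (X : lpt d -> Prop) a :
  densely_similar_free f mu X -> densely_similar_free f mu (fun x => X (x - a)).
Proof.
move=> dense Y uY YX.
have [||Z [uZ ZY free le_Z]] := dense [seq y - a | y <- Y].
- by rewrite map_inj_uniq //; apply: addIr.
- by move=> _ /mapP[y yY ->]; apply: YX.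
exists [seq z + a | z <- Z]; split.
- by rewrite map_inj_uniq //; apply: addIr.
- by move=> _ /mapP[z /ZY /mapP[y yY ->] ->]; rewrite subrK.
- move=> z zZ sim s t; apply: (addIr (- a)).
  apply: (free (fun s => z s - a)); last exact: similar_add.
  by move=> s'; have /mapP[x xZ ->] := zZ s'; rewrite addrK.
- by move: le_Z; rewrite !size_map.
Qed.

Lemma densely_similar_free_union (R : realType) (mu : R) (X : nat -> lpt d -> Prop) :
  (forall r, densely_similar_free f mu (X r)) ->
  (forall (z : K -> lpt d) (rho : K -> nat),
     (forall s, X (rho s) (z s)) -> similar f z -> is_const rho) ->
  densely_similar_free f mu (fun x => exists r, X r x).
Proof.
move=> dense localized Y uY YX.
have /choice[rho rhoP] : forall y, exists r, y \in Y -> X r y.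
  by move=> y; have [/YX[r Xr]|_] := boolP (y \in Y); [exists r|exists 0%N].
pose Yr r := [seq y <- Y | rho y == r].
have YrX r y : y \in Yr r -> X r y.
  by rewrite mem_filter => /andP[/eqP <- /rhoP].
have /choice[Zr ZrP] := fun r => dense r (Yr r) (filter_uniq _ uY) (@YrX r).
pose Z := [seq y <- Y | y \in Zr (rho y)].
exists Z; split.
- exact: filter_uniq.
- exact: mem_subseq (filter_subseq _ _).
- move=> z zZ sim.
  have [zY z_rho] : (forall s, z s \in Y) /\ (forall s, z s \in Zr (rho (z s))).
    by split=> s; have := zZ s; rewrite mem_filter => /andP[].
  have rho_const : is_const (rho \o z).
    by apply: localized sim => s; apply/rhoP/zY.
  move=> s; have [_ _ free _] := ZrP (rho (z s)); apply: (free z _ sim s) => t.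
  by have := z_rho t; rewrite -[rho (z t)](rho_const s t).
- pose rs := undup (map rho Y).
  have rho_rs y : y \in Y -> rho y \in rs by move=> yY; rewrite mem_undup map_f.
  rewrite !(size_sum_fibres (undup_uniq (map rho Y)) (g := rho)) //; last first.
    by move=> y; rewrite mem_filter => /andP[_]; apply: rho_rs.
  rewrite !natr_sum mulr_sumr; apply: ler_sum => r _; have [uZr ZrY _ le_Zr] := ZrP r.
  rewrite -!size_filter; apply: le_trans le_Zr _; rewrite ler_nat.
  apply: uniq_leq_size => // y yZr; have := ZrY y yZr.
  by rewrite !mem_filter => /andP[/eqP -> ->]; rewrite eqxx yZr.
Qed.

End Spreading.

Lemma similar_free_F_free (R : realType) (d : nat) (F Z : seq (lpt d)) :
  (1 < #|{: seq_sub F}|)%N -> similar_free (fun s : seq_sub F => val s) Z -> F_free R F Z.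
Proof.
move=> /card_gt1P[s [t [_ _ neq_st]]] free [lam [g [lam0 [g_isom copy]]]].
have /choice[z zP] : forall s : seq_sub F, exists z,
    z \in Z /\ embed R z = g (lam *: embed R (val s)).
  by move=> a; have [z zZ e] := copy (val a) (valP a); exists z.
have dist a b : (sqdistz (z a) (z b))%:~R = lam ^+ 2 * (sqdistz (val a) (val b))%:~R :> R.
  rewrite -!sqdist_embed (zP a).2 (zP b).2 g_isom /sqdist mulr_sumr.
  by apply: eq_bigr => i _; rewrite !mxE -mulrBr exprMn.
have sim : similar (fun s : seq_sub F => val s) z.
  by move=> a b a' b'; apply: (@intr_inj R); rewrite !rmorphM /= !dist; ring.
have := dist s t; rewrite (free z (fun a => (zP a).1) sim s t) sqdistzz => /esym /eqP.
rewrite mulf_eq0 sqrf_eq0 (negbTE lam0) /= intr_eq0 sqdistz_eq0 (inj_eq val_inj).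
by rewrite (negbTE neq_st).
Qed.

Theorem theorem1p5 (R : realType) (d : nat) (F : seq (lpt d)) (k : nat) (mu : R) :
  (1 <= d)%N -> uniq F -> size F = k -> (3 <= k)%N ->
  0 < mu -> mu < (k%:R - 1) / k%:R ->
  exists X : lpt d -> Prop,
    (forall x, X x -> forall i : 'I_d, 0 <= x 0 i) /\
    (forall r : nat, (1 <= r)%N -> forall c : lpt d -> 'I_r,
        mono_homothetic_copy F X c) /\
    (forall Y : seq (lpt d), uniq Y -> (forall y, y \in Y -> X y) ->
       exists Z : seq (lpt d),
         [/\ uniq Z, {subset Z <= Y}, F_free R F Z & mu * (size Y)%:R <= (size Z)%:R]).
Proof.
move=> d_gt0 uF sF k_gt2 _ mu_lt; pose f (s : seq_sub F) := val s.
have f_inj : injective f by apply: val_inj.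
have cardF : #|{: seq_sub F}| = k by rewrite card_seq_sub.
have F_gt2 : (2 < #|{: seq_sub F}|)%N by rewrite cardF.
have /choice[S SP] : forall r, exists S : seq (lpt d),
    (forall c : lpt d -> 'I_r, mono_homothetic_copy (codom f) (fun x => x \in S) c) /\
    densely_similar_free f mu (fun x => x \in S).
  by move=> r; apply: sparse_lattice_block; rewrite ?cardF.
have [base [base_ge0 localized]] := similar_copies_localized F_gt2 d_gt0 f_inj S.
exists (fun x => exists r, x - base r \in S r); split; last split.
- by move=> x [r /base_ge0].
- move=> r _ c; have [v [lam [col [lam_gt0 copy]]]] :=
    mono_homothetic_copy_translate ((SP r).1 (fun x => c (x + base r))).
  exists v, lam, col; split=> // x xF.
  by have [] := copy x (codom_f f (SeqSub xF)); split=> //; exists r.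
- move=> Y uY YX.
  have dense_union := densely_similar_free_union
    (fun r => densely_similar_free_translate (a := base r) (SP r).2) localized.
  have [Z [uZ ZY free le_Z]] := dense_union Y uY YX.
  by exists Z; split=> //; apply: similar_free_F_free free; apply: ltnW.
Qed.
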